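(* Let $N\ge0$, $\mathbf a_N=(a(0),\dots,a(N))\in\mathbb C^{N+1}$, $P_2>0$, $0<\varepsilon<1$, let $g_1$ be a given spectral density, and $$D_\varepsilon=\left\{g: g=(1-\varepsilon)g_1+\varepsilon w,\ \frac1{2\pi}\int_{-\pi}^\pi g(\lambda)d\lambda\le P_2\right\},$$ $w$ being an arbitrary (unknown) spectral density. Let the spectral density $f(\lambda)$ be known, let $g_0\in D_\varepsilon$, let $\int_{-\pi}^\pi(f+g_0)^{-1}d\lambda<\infty$, put $C_N^0(e^{i\lambda})=\sum_{j=0}^N((\mathbf B_N^0)^{-1}\mathbf R_N^0\mathbf a_N)_je^{ij\lambda}$, and let $$h_g(f,g_0)=\frac{|A_N(e^{i\lambda})f(\lambda)-C_N^0(e^{i\lambda})|^2}{(f(\lambda)+g_0(\lambda))^2}$$ be bounded. Suppose that for some constant $\alpha_2>0$ $$g_0(\lambda)=\max\left\{(1-\varepsilon)g_1(\lambda),\ \alpha_2\left|A_N(e^{i\lambda})f(\lambda)-C_N^0(e^{i\lambda})\right|-f(\lambda)\right\}$$ and that $(f,g_0)$ determines a solution to the optimization problem $$\max_{g\in D_\varepsilon}\left(\langle\mathbf R_N\mathbf a_N,\mathbf B_N^{-1}\mathbf R_N\mathbf a_N\rangle+\langle\mathbf Q_N\mathbf a_N,\mathbf a_N\rangle\right)=\langle\mathbf R_N^0\mathbf a_N,(\mathbf B_N^0)^{-1}\mathbf R_N^0\mathbf a_N\rangle+\langle\mathbf Q_N^0\mathbf a_N,\mathbf a_N\rangle .$$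 Then $g_0$ is the least favourable spectral density in $D_\varepsilon$ for the optimal linear estimate of $A_N\xi=\sum_{j=0}^Na(j)\xi(j)$ from observations of $\xi(j)+\eta(j)$, $j\in\mathbb Z\setminus\{0,\dots,N\}$, and $$h^0(e^{i\lambda})=\frac{A_N(e^{i\lambda})f(\lambda)-C_N^0(e^{i\lambda})}{f(\lambda)+g_0(\lambda)}$$ is the minimax-robust spectral characteristic of the optimal linear estimate of $A_N\xi$.
   Context: $\xi,\eta$ are zero mean uncorrelated wide sense stationary sequences with spectral densities $f,g$ ($E\xi(j+k)\overline{\xi(j)}=\frac1{2\pi}\int e^{ik\lambda}f\,d\lambda$, etc.). $A_N(e^{i\lambda})=\sum_{j=0}^Na(j)e^{ij\lambda}$, $\langle x,y\rangle=\sum_{k=0}^Nx_k\overline{y_k}$. $\mathbf B_N,\mathbf R_N,\mathbf Q_N$ are the $(N+1)\times(N+1)$ matrices with entries $\frac1{2\pi}\int_{-\pi}^\pi e^{-i(j-k)\lambda}\psi(\lambda)d\lambda$, $j,k=0,\dots,N$, with $\psi=\frac1{f+g}$, $\frac f{f+g}$, $\frac{fg}{f+g}$ respectively; superscript $0$ refers to $(f,g_0)$. Wherever $\mathbf B_N^{-1}$ is used, $(f,g)$ is understood to satisfy $\int(f+g)^{-1}d\lambda<\infty$. $L_2^N(f+g)$ is the closed span of $\{e^{ij\lambda}:j\in\mathbb Z\setminus\{0,\dots,N\}\}$ in $L_2(f+g)$; for $h\in L_2^N(f+g)$, $\Delta(h;f,g)=\frac1{2\pi}\int|A_N-h|^2f\,d\lambda+\frac1{2\pi}\int|h|^2g\,d\lambda$,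 and $h(f,g)$ is its minimizer. With $f$ fixed, $g_0$ is least favourable in a class $D_g$ if $\Delta(h(f,g_0);f,g_0)=\max_{g\in D_g}\Delta(h(f,g);f,g)$; $h^0$ is minimax-robust if $h^0\in H_D=\bigcap_{g\in D_g}L_2^N(f+g)$ and $\min_{h\in H_D}\max_{g\in D_g}\Delta(h;f,g)=\sup_{g\in D_g}\Delta(h^0;f,g)$. *)

(* Defs.v *)
From HB Require Import structures.
From mathcomp Require Import all_boot all_order all_algebra.
From mathcomp Require Import all_classical all_reals all_analysis.
From mathcomp Require Import complex.

Set Implicit Arguments.
Unset Strict Implicit.
Unset Printing Implicit Defensive.

Import Order.TTheory GRing.Theory Num.Theory.

Local Open Scope classical_set_scope.
Local Open Scope ring_scope.
Local Open Scope complex_scope.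

(* Spectral densities are real functions on the line, of which only the *)
(* restriction to [-pi, pi] matters; they are meant up to Lebesgue-null sets, *)
(* so pointwise identities and bounds between them are stated almost *)
(* everywhere. The complex numbers are R[i]. *)

Section Interpolation.
Variable R : realType.
Local Notation mu := (@lebesgue_measure R).
Implicit Types (f g u psi : R -> R) (h : R -> R[i]) (D : set (R -> R)).

Definition period : set R := `[- pi, pi].

(* |z| as an element of R (in R[i] the norm `|z| is a complex number). *)
Definition cabs (z : R[i]) : R :=
  Num.sqrt (complex.Re z ^+ 2 + complex.Im z ^+ 2).

(* e^{i k x} *)
Definition cexp (k : int) (x : R) : R[i] :=
  cos (k%:~R * x) +i* sin (k%:~R * x).

(* (2 pi)^-1 times the integral over [-pi, pi], with values in [0, +oo]; only *)
(* used for nonnegative integrands. *)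
Definition mean (F : R -> \bar R) : \bar R :=
  (((2 * pi)^-1)%:E * \int[mu]_(x in period) F x)%E.

Definition cmean (F : R -> R[i]) : R[i] :=
  ((2 * pi)^-1)%:C *
  ((\int[mu]_(x in period) complex.Re (F x)) +i*
   (\int[mu]_(x in period) complex.Im (F x))).

Definition spectral_density f : Prop :=
  mu.-integrable period (EFin \o f) /\ (forall x, period x -> 0 <= f x).

(* The inverse is taken in \bar R, where 0^-1 = +oo, so that the condition *)
(* forces f + g > 0 almost everywhere. *)
Definition inv_integrable f g : Prop :=
  (\int[mu]_(x in period) ((f x + g x)%:E)^-1 < +oo)%E.

Section FixedN.
Variable N : nat.
Implicit Types (a c : 'cV[R[i]]_N.+1).

Definition toeplitz psi : 'M[R[i]]_N.+1 :=
  \matrix_(j, k) cmean (fun x => cexp (- (j%:Z - k%:Z)) x * (psi x)%:C).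

Definition Bmx f g := toeplitz (fun x => (f x + g x)^-1).
Definition Rmx f g := toeplitz (fun x => f x / (f x + g x)).
Definition Qmx f g := toeplitz (fun x => f x * g x / (f x + g x)).

Definition dotc a c : R[i] := \sum_(k < N.+1) a k 0 * (c k 0)^*.

(* c(0) + c(1) e^{ix} + ... + c(N) e^{iNx} *)
Definition trigpoly c (x : R) : R[i] := \sum_(j < N.+1) c j 0 * cexp j%:Z x.

Definition Ccoef a f g : 'cV[R[i]]_N.+1 :=
  invmx (Bmx f g) *m (Rmx f g *m a).

(* A_N f - C_N *)
Definition numer a f g (x : R) : R[i] :=
  trigpoly a x * (f x)%:C - trigpoly (Ccoef a f g) x.

Definition objective a f g : R[i] :=
  dotc (Rmx f g *m a) (invmx (Bmx f g) *m (Rmx f g *m a)) +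
  dotc (Qmx f g *m a) a.

(* Finite linear combinations of e^{ikx}, k an integer outside {0, ..., N}. *)
Definition observed h : Prop :=
  exists (s : seq int) (c : int -> R[i]),
    (forall k : int, k \in s -> ~~ (0 <= k <= N%:Z)) /\
    h = (fun x => \sum_(k <- s) c k * cexp k x).

Definition wdist2 u h1 h2 : \bar R :=
  mean (fun x => (cabs (h1 x - h2 x) ^+ 2 * u x)%:E).

(* L_2^N(u): the closure, in the Hilbert space L_2(u), of [observed]. *)
Definition L2N u : set (R -> R[i]) := [set h |
  [/\ measurable_fun period (fun x => complex.Re (h x)),
      measurable_fun period (fun x => complex.Im (h x)),
      (wdist2 u h (fun=> 0%R) < +oo)%E &
      forall e : R, 0 < e ->
        exists p, observed p /\ (wdist2 u h p < e%:E)%E]].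

Definition Delta a h f g : \bar R :=
  (mean (fun x => (cabs (trigpoly a x - h x) ^+ 2 * f x)%:E) +
   mean (fun x => (cabs (h x) ^+ 2 * g x)%:E))%E.

(* h is the optimal spectral characteristic h(f,g); it is determined only as *)
(* an element of L_2(f+g), hence a relation rather than a function. *)
Definition optimal a f g h : Prop :=
  L2N (f \+ g) h /\
  forall h', L2N (f \+ g) h' -> (Delta a h f g <= Delta a h' f g)%E.

(* The maximum over g in D of Delta(h(f,g); f, g) is attained at g0. *)
Definition least_favourable a f D g0 : Prop :=
  D g0 /\
  exists h0, optimal a f g0 h0 /\
    forall g h, D g -> optimal a f g h -> (Delta a h f g <= Delta a h0 f g0)%E.

Definition HD f D : set (R -> R[i]) := \bigcap_(g in D) L2N (f \+ g).

Definition max_error a f D h : \bar R := ereal_sup [set Delta a h f g | g in D].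

Definition minimax_robust a f D h0 : Prop :=
  HD f D h0 /\
  ereal_inf [set max_error a f D h | h in HD f D] = max_error a f D h0.

End FixedN.

(* The eps-contamination class D_eps of g1, of mean power at most P2. *)
Definition contamination (eps P2 : R) g1 : set (R -> R) := [set g |
  [/\ spectral_density g,
      exists w, spectral_density w /\
        \forall x \ae mu, period x -> g x = (1 - eps) * g1 x + eps * w x &
      (mean (fun x => (g x)%:E) <= P2%:E)%E]].

End Interpolation.

Arguments period {R}.

(* Main.v *)
(** Write h0 for the characteristic at (f, g0), u = f + g0 and C = C_N^0.
Pointwise, where u > 0, the error integrand at h exceeds that at h0 by
|h - h0|^2 u - 2 Re ((h - h0) conj C). The equation B c = R a says exactly
that the Fourier coefficients of h0 of index 0..N vanish; those of every h in
L_2^N(u) vanish as well, so the last term has mean zero and h0 is optimal.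

The max formula for g0 gives |h0| <= 1/alpha2, so h0 is bounded; trigonometric
polynomials being dense in weighted L_2, a bounded function with vanishing
coefficients 0..N lies in L_2^N(f+g) for every g in the class.

Moreover |h0|^2 (g - g0) <= alpha2^-2 (g - g0), since |h0| = 1/alpha2 where
g0 > (1-eps) g1 and g >= g0 elsewhere. If g0 uses the full power P2, integration gives
Delta(h0; f, g) <= Delta(h0; f, g0); if it does not, comparing the objective
at g0 and at g0 + t forces h0 = 0. This saddle point inequality yields both
conclusions. *)

Require Import Defs.
From HB Require Import structures.
From mathcomp Require Import all_boot all_order all_algebra.
From mathcomp Require Import all_classical all_reals all_analysis.
From mathcomp Require Import complex ring lra measurable_realfun.

Import Order.TTheory GRing.Theory Num.Theory.
Import numFieldNormedType.Exports.
Local Open Scope classical_set_scope.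
Local Open Scope ring_scope.
Local Open Scope complex_scope.

Set Implicit Arguments.
Unset Strict Implicit.
Unset Printing Implicit Defensive.

(** * Integrals of real functions over [-pi, pi], with almost everywhere conditions *)

Section RealIntegralOnPeriod.
Context {R : realType}.
Local Notation mu := (@lebesgue_measure R).
Implicit Types (F G H : R -> R) (P Q S : R -> Prop).

(** The two directions of the description of L_2^N(f+g) are asymmetric. That its members have
    vanishing coefficients 0..N rests on the integrability of 1/(f+g), which is given at g0; but
    [HD] runs over every g of the class, where 1/(f+g) may fail to be integrable. Membership of h0
    is therefore derived from its boundedness, through an approximation that works for any
    integrable weight.

    The density behind it is obtained by measure theory: for a suitable trigonometric polynomial q
    the functions (1 - q^n)^(2^n) converge to the indicator of a half-line, a Dynkin class argument
    reaches all Borel sets, and layers reach all bounded functions.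

    When the power of g0 is below P2, a member g may carry more mass than g0, so the pointwise bound
    on |h0|^2 (g - g0) decides nothing. Maximality of the objective enters there: adding a constant
    t to g0 amounts to adding t/eps to w, so g0 + t is a competitor as long as the power allows
    it. *)

Definition rint F : R := \int[mu]_(x in period) F x.
Definition integ F : Prop := mu.-integrable period (EFin \o F).
Definition mfun F : Prop := measurable_fun period F.
Definition aep P : Prop := \forall x \ae mu, period x -> P x.

Lemma measurable_period : measurable (@period R).
Proof. exact: measurable_itv. Qed.
Hint Resolve measurable_period : core.

Lemma mu_period : (mu period = (2 * pi)%:E)%E.
Proof.
rewrite /period lebesgue_measure_itv/= lte_fin ltrNl opprK.
have pi0 := pi_gt0 R.
have -> : (- pi < pi :> R) by lra.
by congr EFin; lra.
Qed.

Lemma aepT P : (forall x, period x -> P x) -> aep P.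
Proof. by move=> h; apply: aeW. Qed.

Lemma aepS P Q : (forall x, period x -> P x -> Q x) -> aep P -> aep Q.
Proof.
by move=> h; apply: (@filterS _ _ (ae_filter_ringOfSetsType mu)) => x hx px;
   apply: h => //; exact: hx.
Qed.

Lemma aepS2 P Q S : (forall x, period x -> P x -> Q x -> S x) ->
  aep P -> aep Q -> aep S.
Proof.
move=> h; apply: (@filterS2 _ _ (ae_filter_ringOfSetsType mu)) => x h1 h2 px.
by apply: h => //; [exact: h1|exact: h2].
Qed.

Lemma integ_mfun F : integ F -> mfun F.
Proof. by move=> /measurable_int/measurable_EFinP. Qed.

Lemma mfunD F G : mfun F -> mfun G -> mfun (fun x => F x + G x).
Proof. exact: measurable_funD. Qed.
Lemma mfunB F G : mfun F -> mfun G -> mfun (fun x => F x - G x).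
Proof. exact: measurable_funB. Qed.
Lemma mfunM F G : mfun F -> mfun G -> mfun (fun x => F x * G x).
Proof. exact: measurable_funM. Qed.
Lemma mfun_cst c : mfun (fun=> c).
Proof. exact: measurable_cst. Qed.
Lemma mfunX n F : mfun F -> mfun (fun x => F x ^+ n).
Proof. exact: measurable_funX. Qed.
Lemma mfun_norm F : mfun F -> mfun (fun x => `|F x|).
Proof. by move=> mF; apply: measurableT_comp. Qed.

(** Inversion is continuous away from 0, and the single point 0, where the value is 0 by convention,
    is split off. *)
Lemma measurable_inv : measurable_fun [set: R] (@GRing.inv R).
Proof.
have -> : @GRing.inv R = (fun x => if x == 0 then 0 else x^-1).
  by apply/funext => x; case: eqP => // ->; rewrite invr0.
apply: measurable_fun_if => //.
- by apply: measurable_fun_eqr.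
- rewrite setTI; apply: open_continuous_measurable_fun.
    have -> : (fun x : R => x == 0) @^-1` [set false] = ~` [set 0].
      by apply/seteqP; split => x /=; [move=> /eqP|move=> /eqP/negbTE].
    by rewrite openC; apply: closed_eq.
  by move=> x; rewrite inE/= => /eqP x0; apply: inv_continuous; apply/eqP.
Qed.

Lemma mfunV F : mfun F -> mfun (fun x => (F x)^-1).
Proof. by move=> mF; apply: measurableT_comp => //; exact: measurable_inv. Qed.

Lemma integD F G : integ F -> integ G -> integ (fun x => F x + G x).
Proof. by move=> iF iG; apply: (@integrableD _ _ _ mu _ _ (EFin \o F) (EFin \o G)). Qed.
Lemma integB F G : integ F -> integ G -> integ (fun x => F x - G x).
Proof. by move=> iF iG; apply: (@integrableB _ _ _ mu _ _ (EFin \o F) (EFin \o G)). Qed.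
Lemma integZ c F : integ F -> integ (fun x => c * F x).
Proof. by move=> iF; apply: (@integrableZl _ _ _ mu _ _ c (EFin \o F)). Qed.
Lemma integN F : integ F -> integ (fun x => - F x).
Proof.
move=> /(@integZ (-1)); congr integ; apply/funext => x; by rewrite mulN1r.
Qed.
Lemma integ_cst c : integ (fun=> c).
Proof.
apply/integrableP; split; first exact/measurable_EFinP/measurable_cst.
rewrite (_ : (fun x => _) = cst `|c|%:E)%E; last by apply/funext => x.
by rewrite integral_cst//= mu_period ltry.
Qed.

Lemma integ_dom F G : mfun F -> aep (fun x => `|F x| <= G x) -> integ G ->
  integ F.
Proof.
move=> mF FG iG; apply/integrableP; split; first exact/measurable_EFinP.
have /integrableP[mG Goo] := iG.
apply: le_lt_trans Goo; apply: ae_ge0_le_integral => //.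
- by apply/measurableT_comp => //; exact/measurable_EFinP.
- by apply/measurableT_comp.
- apply: aepS FG => x _ /= h; rewrite lee_fin (le_trans h)//.
  exact: ler_norm.
Qed.

Lemma integ_bdd M F : mfun F -> aep (fun x => `|F x| <= M) -> integ F.
Proof. by move=> mF FM; apply: integ_dom FM (integ_cst M). Qed.

Lemma integ_norm F : integ F -> integ (fun x => `|F x|).
Proof.
move=> iF; have /integrable_norm := iF; exact.
Qed.

Lemma integMbdd M F G : mfun F -> aep (fun x => `|F x| <= M) -> integ G ->
  integ (fun x => F x * G x).
Proof.
move=> mF FM iG.
apply: (@integ_dom _ (fun x => M * `|G x|)).
- by apply: mfunM => //; exact: integ_mfun.
- by apply: aepS FM => x _ h; rewrite normrM ler_wpM2r.
- by apply: integZ; exact: integ_norm.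
Qed.

Lemma rintD F G : integ F -> integ G ->
  rint (fun x => F x + G x) = rint F + rint G.
Proof. exact: RintegralD. Qed.
Lemma rintB F G : integ F -> integ G ->
  rint (fun x => F x - G x) = rint F - rint G.
Proof. exact: RintegralB. Qed.
Lemma rintZ c F : integ F -> rint (fun x => c * F x) = c * rint F.
Proof. by move=> iF; exact: RintegralZl. Qed.
Lemma rintN F : integ F -> rint (fun x => - F x) = - rint F.
Proof.
by move=> /(rintZ (-1)); rewrite mulN1r => <-; congr rint;
   apply/funext => x; rewrite mulN1r.
Qed.
Lemma rint_cst c : rint (fun=> c) = c * (2 * pi).
Proof. by rewrite /rint Rintegral_cst//= mu_period. Qed.

Lemma eq_rint F G : (forall x, period x -> F x = G x) -> rint F = rint G.
Proof. by move=> h; apply: eq_Rintegral => x /set_mem; exact: h. Qed.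

Lemma aep_eq_rint F G : mfun F -> mfun G -> aep (fun x => F x = G x) ->
  rint F = rint G.
Proof.
move=> mF mG FG; rewrite /rint /Rintegral; congr fine.
apply: ae_eq_integral => //; [exact/measurable_EFinP|exact/measurable_EFinP|].
by apply: aepS FG => x _ /= ->.
Qed.

Lemma rint_ge0 F : mfun F -> aep (fun x => 0 <= F x) -> 0 <= rint F.
Proof.
move=> mF F0; rewrite (@aep_eq_rint _ (fun x => `|F x|))//.
- by apply: Rintegral_ge0.
- exact: mfun_norm.
- by apply: aepS F0 => x _ /ger0_norm ->.
Qed.

Lemma le_rint F G : integ F -> integ G -> aep (fun x => F x <= G x) ->
  rint F <= rint G.
Proof.
move=> iF iG FG; rewrite -subr_ge0 -rintB//; apply: rint_ge0.
  by apply: mfunB; exact: integ_mfun.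
by apply: aepS FG => x _; rewrite subr_ge0.
Qed.

Lemma rint_norm F : integ F -> `|rint F| <= rint (fun x => `|F x|).
Proof. by move=> iF; exact: le_normr_Rintegral. Qed.

Lemma integralE F : integ F -> (\int[mu]_(x in period) (F x)%:E = (rint F)%:E)%E.
Proof. by move=> iF; rewrite /rint /Rintegral fineK// integrable_fin_num. Qed.

Lemma rint_eq0_aep F : integ F -> aep (fun x => 0 <= F x) -> rint F = 0 ->
  aep (fun x => F x = 0).
Proof.
move=> iF F0 r0.
have mF := integ_mfun iF.
have : (\int[mu]_(x in period) `|(F x)%:E| = 0)%E.
  under eq_integral do rewrite abse_EFin.
  rewrite (integralE (integ_norm iF)); congr EFin; rewrite -r0.
  apply: aep_eq_rint => //; first exact: mfun_norm.
  by apply: aepS F0 => x _ /ger0_norm ->.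
move/ae_eq_integral_abs => /(_ measurable_period).
have /measurable_EFinP mEF := mF.
by move=> /(_ mEF); apply: aepS => x _ /= [->].
Qed.

Lemma mean_rint F : integ F ->
  mean (fun x => (F x)%:E) = ((2 * pi)^-1 * rint F)%:E.
Proof. by move=> iF; rewrite /mean integralE. Qed.

Lemma integ_mean_lty F : mfun F -> (forall x, period x -> 0 <= F x) ->
  (mean (fun x => (F x)%:E) < +oo)%E -> integ F.
Proof.
move=> mF F0; rewrite /mean => h; apply/integrableP; split.
  exact/measurable_EFinP.
have pi0 := pi_gt0 R.
have c0 : (0 < ((2 * pi)^-1)%:E :> \bar R)%E.
  by rewrite lte_fin invr_gt0 mulr_gt0.
under eq_integral => x /set_mem px.
  rewrite /= ger0_norm; last exact: F0.
  over.
rewrite ltey; apply/eqP => hoo; move: h; rewrite hoo.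
by rewrite gt0_muley.
Qed.

Lemma rint_dominated_cvg0 (F_ : nat -> R -> R) G :
  (forall n, mfun (F_ n)) -> integ G ->
  aep (fun x => forall n, `|F_ n x| <= G x) ->
  aep (fun x => F_ ^~ x @ \oo --> (0 : R)) ->
  rint (F_ n) @[n --> \oo] --> (0 : R).
Proof.
move=> mF iG FG F0.
have iF n : integ (F_ n).
  by apply: integ_dom iG => //; apply: aepS FG => x _ /(_ n).
have mEF n : measurable_fun period (fun x => (F_ n x)%:E).
  by have /measurable_EFinP := mF n.
have F0E : {ae mu, forall x, period x -> (F_ n x)%:E @[n --> \oo] --> (cst 0%E x : \bar R)}.
  by apply: aepS F0 => x px; move=> h; apply: cvg_EFin h; exact: nearW.
have FGE : {ae mu, forall x n, period x -> (`|(F_ n x)%:E| <= (G x)%:E)%E}.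
  apply: (@filterS _ _ (ae_filter_ringOfSetsType mu)) FG => x h n px.
  by rewrite lee_fin; exact: h.
have [_ _] := @dominated_convergence _ _ _ mu period measurable_period
  (fun n x => (F_ n x)%:E) (cst 0%E) (EFin \o G) mEF (measurable_cst _)
  F0E iG FGE.
rewrite integral0 (_ : (fun n => _) = (fun n => (rint (F_ n))%:E)); last first.
  by apply/funext => n; rewrite integralE.
by move/fine_cvgP => [].
Qed.

End RealIntegralOnPeriod.
#[global] Hint Resolve measurable_period : core.

(** * Approximation by real trigonometric polynomials in weighted L_2 *)

Section TrigonometricDensity.
Context {R : realType}.
Local Notation mu := (@lebesgue_measure R).
Implicit Types (h p q w : R -> R).

(** Trigonometric polynomials as the algebra generated by [cos] and [sin]: closure under products is
    built in, as the iterated powers used below require. Frequencies appear only on conversion to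
    exponentials. *)
Inductive rtrig : (R -> R) -> Prop :=
| rtrig_cst c : rtrig (fun=> c)
| rtrig_cos : rtrig cos
| rtrig_sin : rtrig sin
| rtrigD p q of rtrig p & rtrig q : rtrig (fun x => p x + q x)
| rtrigM p q of rtrig p & rtrig q : rtrig (fun x => p x * q x).

Lemma rtrigX p n : rtrig p -> rtrig (fun x => p x ^+ n).
Proof.
move=> tp; elim: n => [|n ih].
  by under eq_fun do rewrite expr0; exact: rtrig_cst.
by under eq_fun do rewrite exprS; exact: rtrigM.
Qed.

Lemma rtrigZ c p : rtrig p -> rtrig (fun x => c * p x).
Proof. by move=> tp; apply: rtrigM => //; exact: rtrig_cst. Qed.

Lemma rtrigBc c p : rtrig p -> rtrig (fun x => c - p x).
Proof.
move=> tp; under eq_fun do rewrite -mulN1r.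
by apply: rtrigD; [exact: rtrig_cst|exact: rtrigZ].
Qed.

Definition bm h : Prop := mfun h /\ exists M : R, aep (fun x => `|h x| <= M).

Lemma bm_cst c : bm (fun=> c).
Proof. by split; [exact: mfun_cst|exists `|c|; exact: aepT]. Qed.

Lemma bmD h p : bm h -> bm p -> bm (fun x => h x + p x).
Proof.
move=> [mh [M hM]] [mp [L pL]]; split; first exact: mfunD.
exists (M + L); apply: aepS2 hM pL => x _ h1 h2.
by rewrite (le_trans (ler_normD _ _))// lerD.
Qed.

Lemma bmM h p : bm h -> bm p -> bm (fun x => h x * p x).
Proof.
move=> [mh [M hM]] [mp [L pL]]; split; first exact: mfunM.
exists (M * L); apply: aepS2 hM pL => x _ h1 h2.
by rewrite normrM ler_pM.
Qed.

Lemma bmB h p : bm h -> bm p -> bm (fun x => h x - p x).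
Proof.
move=> bh bp; under eq_fun do rewrite -mulN1r.
by apply: bmD => //; apply: bmM => //; exact: bm_cst.
Qed.

Lemma bmX h n : bm h -> bm (fun x => h x ^+ n).
Proof.
move=> bh; elim: n => [|n ih].
  by under eq_fun do rewrite expr0; exact: bm_cst.
by under eq_fun do rewrite exprS; exact: bmM.
Qed.

Lemma continuous_mfun h : continuous h -> mfun h.
Proof. by move=> ch; apply: measurable_funTS; exact: continuous_measurable_fun. Qed.

Lemma bm_cos : bm cos.
Proof.
split; first by apply: continuous_mfun; exact: continuous_cos.
by exists 1; apply: aepT => x _; rewrite ler_norml cos_geN1 cos_le1.
Qed.

Lemma bm_sin : bm sin.
Proof.
split; first by apply: continuous_mfun; exact: continuous_sin.
by exists 1; apply: aepT => x _; rewrite ler_norml sin_geN1 sin_le1.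
Qed.

Lemma rtrig_bm p : rtrig p -> bm p.
Proof.
elim=> [c|||{}p q _ bp _ bq|{}p q _ bp _ bq].
- exact: bm_cst.
- exact: bm_cos.
- exact: bm_sin.
- exact: bmD.
- exact: bmM.
Qed.

Lemma bm_indic (S : set R) : measurable S -> bm \1_S.
Proof.
move=> mS; split; first exact: measurable_indic.
exists 1; apply: aepT => x _; rewrite indicE.
by case: (x \in S); rewrite ?normr1 ?normr0.
Qed.

Lemma integ_bmM h w : bm h -> integ w -> integ (fun x => h x * w x).
Proof. by move=> [mh [M hM]] iw; exact: integMbdd hM iw. Qed.

Section Weight.
Variable w : R -> R.
Hypothesis iw : integ w.
Hypothesis w0 : aep (fun x => 0 <= w x).

Definition d2 h p := rint (fun x => (h x - p x) ^+ 2 * w x).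

Lemma integ_d2 h p : bm h -> bm p -> integ (fun x => (h x - p x) ^+ 2 * w x).
Proof. by move=> bh bp; apply: integ_bmM => //; apply: bmX; exact: bmB. Qed.

(** The inequality (s + t)^2 <= 2 s^2 + 2 t^2 serves as triangle inequality, so that squared
    distances suffice throughout. *)
Lemma le_d2 h p q : bm h -> bm p -> bm q ->
  d2 h p <= 2 * d2 h q + 2 * d2 q p.
Proof.
move=> bh bp bq; rewrite /d2 -!rintZ -?rintD;
  do ?[exact: integ_d2|apply: integZ].
apply: le_rint; first exact: integ_d2.
  by apply: integD; apply: integZ; exact: integ_d2.
apply: aepS w0 => x _ wx; rewrite !mulrA -mulrDl ler_wpM2r//.
by have := sqr_ge0 ((h x - q x) - (q x - p x)); nra.
Qed.

Definition approx_rtrig h :=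
  forall e, 0 < e -> exists p, rtrig p /\ d2 h p < e.

Lemma rtrig_approx p : rtrig p -> approx_rtrig p.
Proof.
move=> tp e e0; exists p; split => //; rewrite /d2.
by rewrite (_ : (fun _ => _) = (fun=> 0)) ?rint_cst ?mul0r//;
  apply/funext => x; rewrite subrr expr0n mul0r.
Qed.

Lemma approx_close h : bm h ->
  (forall e, 0 < e -> exists q, [/\ bm q, approx_rtrig q & d2 h q < e]) ->
  approx_rtrig h.
Proof.
move=> bh H e e0; have e4 : 0 < e / 4 by rewrite divr_gt0.
have [q [bq aq hq]] := H _ e4; have [p [tp qp]] := aq _ e4.
exists p; split => //.
apply: le_lt_trans (le_d2 bh (rtrig_bm tp) bq) _; lra.
Qed.

Lemma approxD h q : bm h -> bm q -> approx_rtrig h -> approx_rtrig q ->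
  approx_rtrig (fun x => h x + q x).
Proof.
move=> bh bq ah aq e e0; have e4 : 0 < e / 4 by rewrite divr_gt0.
have [p1 [t1 hp1]] := ah _ e4; have [p2 [t2 hp2]] := aq _ e4.
have b1 := rtrig_bm t1; have b2 := rtrig_bm t2.
exists (fun x => p1 x + p2 x); split; first exact: rtrigD.
apply: (@le_lt_trans _ _ (2 * d2 h p1 + 2 * d2 q p2)); last lra.
rewrite /d2 -!rintZ -?rintD; do ?[exact: integ_d2|apply: integZ].
apply: le_rint; first by apply: integ_d2; exact: bmD.
  by apply: integD; apply: integZ; exact: integ_d2.
apply: aepS w0 => x _ wx; rewrite !mulrA -mulrDl ler_wpM2r//.
by have := sqr_ge0 ((h x - p1 x) - (q x - p2 x)); nra.
Qed.

Lemma approxZ c h : bm h -> approx_rtrig h -> approx_rtrig (fun x => c * h x).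
Proof.
(* Dividing by c^2 + 1 instead of c^2 covers c = 0 as well. *)
move=> bh ah e e0; have c0 : 0 < c ^+ 2 + 1 by have := sqr_ge0 c; lra.
have [|p [tp hp]] := ah (e / (c ^+ 2 + 1)); first by rewrite divr_gt0.
exists (fun x => c * p x); split; first exact: rtrigZ.
have bp := rtrig_bm tp.
have -> : d2 (fun x => c * h x) (fun x => c * p x) = c ^+ 2 * d2 h p.
  rewrite /d2 -rintZ; last exact: integ_d2.
  by congr rint; apply/funext => x; ring.
move: hp; rewrite ltr_pdivlMr//; apply: le_lt_trans.
rewrite mulrC ler_wpM2l; [by []| |by lra].
apply: rint_ge0; first by apply: integ_mfun; exact: integ_d2.
by apply: aepS w0 => x _ wx; rewrite mulr_ge0// sqr_ge0.
Qed.

(** Bounded almost everywhere convergence implies convergence in L_2(w): the squared differences are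
    dominated by (L + M)^2 w. *)
Lemma approx_cvg (h_ : nat -> R -> R) h (M : R) : bm h ->
  (forall n, mfun (h_ n)) -> aep (fun x => forall n, `|h_ n x| <= M) ->
  (forall n, approx_rtrig (h_ n)) ->
  aep (fun x => h_ n x @[n --> \oo] --> h x) -> approx_rtrig h.
Proof.
move=> bh mh hM ah hh.
have bn n : bm (h_ n).
  by split => //; exists M; apply: aepS hM => x _ /(_ n).
have [_ [L hL]] := bh.
have : (fun n => d2 h (h_ n)) @ \oo --> (0 : R).
  apply: (@rint_dominated_cvg0 _ _ (fun x => (L + M) ^+ 2 * w x)).
  - by move=> n; apply: integ_mfun; exact: integ_d2.
  - exact: integZ.
  - have hLM : aep (fun x => forall n, `|h x| <= L /\ `|h_ n x| <= M).
      by apply: aepS2 hL hM => x _ h1 h2 n.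
    apply: aepS2 hLM w0 => x _ h12 wx n; have [h1 h2] := h12 n.
    rewrite normrM (ger0_norm wx) ler_wpM2r// ger0_norm ?sqr_ge0//.
    rewrite -real_normK ?num_real// lerXn2r ?nnegrE//.
      by have := normr_ge0 (h x); have := normr_ge0 (h_ n x); lra.
    by rewrite (le_trans (ler_normB _ _))// lerD.
  - apply: aepS hh => x _ cx.
    have c1 : h x - h_ n x @[n --> \oo] --> (0 : R).
      by rewrite -(subrr (h x)); apply: cvgB => //; exact: cvg_cst.
    have c2 := cvgM (cvgM c1 c1) (@cvg_cst _ (w x) _ \oo _).
    rewrite !mul0r in c2; exact: c2.
move=> c0; apply: approx_close => // e e0.
have /cvgrPdist_lt /(_ e e0) [n _ /(_ n (leqnn n))] := c0.
rewrite sub0r normrN => hn; exists (h_ n); split => //.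
exact: le_lt_trans (ler_norm _) hn.
Qed.

End Weight.
End TrigonometricDensity.

(** * Iterated powers converging to a step at 1/2 *)

Section PowerSteps.
Context {R : realType}.
Implicit Types (t q : R).

Lemma bernoulli t m : - 1 <= t -> 1 + m%:R * t <= (1 + t) ^+ m.
Proof.
move=> t1; elim: m => [|m ih]; first by rewrite mul0r expr0 addr0.
rewrite exprS; apply: (@le_trans _ _ ((1 + t) * (1 + m%:R * t))).
  rewrite -subr_ge0 -natr1.
  have -> : (1 + t) * (1 + m%:R * t) - (1 + (m%:R + 1) * t) = m%:R * t ^+ 2.
    by ring.
  by rewrite mulr_ge0// sqr_ge0.
by rewrite ler_wpM2l//; lra.
Qed.

Lemma pow_step_ge0_le1 q n : 0 <= q <= 1 -> 0 <= (1 - q ^+ n) ^+ (2 ^ n) <= 1.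
Proof.
move=> /andP[q0 q1]; have : 0 <= q ^+ n <= 1.
  by rewrite exprn_ge0//= exprn_ile1.
by move=> /andP[a b]; rewrite exprn_ge0/= ?exprn_ile1; lra.
Qed.

(** Bernoulli's inequality with t = - q^n and exponent 2^n bounds the expression below by 1 -
    (2q)^n. *)
Lemma pow_step_cvg1 q : 0 <= q < 2^-1 ->
  (1 - q ^+ n) ^+ (2 ^ n) @[n --> \oo] --> (1 : R).
Proof.
move=> /andP[q0 q2].
have c : (fun n => 1 - (2 * q) ^+ n) @ \oo --> (1 : R).
  rewrite -[X in _ --> X]subr0; apply: cvgB; first exact: cvg_cst.
  by apply: cvg_expr; rewrite ger0_norm; lra.
apply: (squeeze_cvgr _ c (@cvg_cst _ (1 : R) _ \oo _)).
apply: nearW => n /=.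
have q1 : 0 <= q <= 1 by lra.
have /andP[_ ->] := pow_step_ge0_le1 n q1; rewrite andbT.
have := @bernoulli (- q ^+ n) (2 ^ n).
rewrite natrX exprMn mulrN; apply.
by rewrite lerN2 exprn_ile1//; lra.
Qed.

(** Multiplied by (1 + q^n)^(2^n) the expression becomes (1 - q^(2n))^(2^n) <= 1, while that factor
    is at least (2q)^n by Bernoulli's inequality. Hence the bound (2q)^(-n). *)
Lemma pow_step_cvg0 q : 2^-1 < q <= 1 ->
  (1 - q ^+ n) ^+ (2 ^ n) @[n --> \oo] --> (0 : R).
Proof.
move=> /andP[q2 q1].
have c : (fun n => (2 * q)^-1 ^+ n) @ \oo --> (0 : R).
  apply: cvg_expr; rewrite ger0_norm ?invr_ge0; last lra.
  by rewrite invf_lt1; lra.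
apply: (squeeze_cvgr _ (@cvg_cst _ (0 : R) _ \oo _) c).
apply: nearW => n /=.
have q01 : 0 <= q <= 1 by lra.
have /andP[-> _] := pow_step_ge0_le1 n q01; rewrite /=.
have qn : 0 <= q ^+ n <= 1 by rewrite exprn_ge0/= ?exprn_ile1; lra.
have B := @bernoulli (q ^+ n) (2 ^ n).
rewrite exprVn -[X in _ <= X]mul1r ler_pdivlMr ?exprn_gt0//; last lra.
apply: (@le_trans _ _ ((1 - q ^+ n) ^+ (2 ^ n) * (1 + q ^+ n) ^+ (2 ^ n))).
  rewrite ler_wpM2l//.
    by have /andP[] := pow_step_ge0_le1 n q01.
  rewrite exprMn; have := B; rewrite natrX; lra.
by rewrite -exprMn; apply: exprn_ile1; nra.
Qed.

End PowerSteps.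

(** * Density: from half-lines to Borel sets to bounded measurable functions *)

Section HalfLines.
Context {R : realType}.
Local Notation mu := (@lebesgue_measure R).

Lemma aep_neq (c : R) : aep (fun x => x != c).
Proof.
exists [set c]; split; first exact: measurable_set1.
  by rewrite lebesgue_measure_set1.
move=> x /= h; apply: contrapT => xc; apply: h => _.
by apply/eqP.
Qed.

(* 1/2 - sin((x-a)/2) sin((pi-x)/2) / 2: for a in [-pi, pi] it separates the
   points of [-pi, pi] on either side of a, and it is a trigonometric
   polynomial by the product formula. *)
Definition sep (a x : R) : R :=
  2^-1 - 4^-1 * (cos x * cos ((a + pi) / 2) + sin x * sin ((a + pi) / 2)
                 - cos ((pi - a) / 2)).

Lemma sepE a x : sep a x = 2^-1 - 2^-1 * (sin ((x - a) / 2) * sin ((pi - x) / 2)).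
Proof.
rewrite /sep.
have -> : cos x * cos ((a + pi) / 2) + sin x * sin ((a + pi) / 2) =
   cos ((x - a) / 2 - (pi - x) / 2).
  rewrite [in RHS](_ : _ - _ = x - (a + pi) / 2); last lra.
  by rewrite cosB.
have -> : cos ((pi - a) / 2) = cos ((x - a) / 2 + (pi - x) / 2).
  by congr cos; lra.
by rewrite cosB cosD; lra.
Qed.

Lemma rtrig_sep a : rtrig (sep a).
Proof.
apply: rtrigBc; apply: rtrigZ.
under eq_fun do rewrite mulrC [X in _ + X - _]mulrC.
apply: rtrigD; last exact: rtrig_cst.
by apply: rtrigD; apply: rtrigZ; [exact: rtrig_cos|exact: rtrig_sin].
Qed.

Lemma sep_ge0_le1 a x : 0 <= sep a x <= 1.
Proof.
rewrite sepE; set s := sin _; set t := sin _.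
have : -1 <= s <= 1 by rewrite sin_geN1 sin_le1.
have : -1 <= t <= 1 by rewrite sin_geN1 sin_le1.
move=> /andP[t1 t2] /andP[s1 s2]; apply/andP; split; nra.
Qed.

Lemma sep_lt a x : -pi <= a -> a < x < pi -> sep a x < 2^-1.
Proof.
move=> pa /andP[ax xp]; rewrite sepE.
have : 0 < sin ((x - a) / 2) by apply: sin_gt0_pi; lra.
have : 0 < sin ((pi - x) / 2) by apply: sin_gt0_pi; lra.
by move=> s t; have := mulr_gt0 s t; lra.
Qed.

Lemma sep_gt a x : a <= pi -> - pi < x < a -> 2^-1 < sep a x.
Proof.
move=> pa /andP[px xa]; rewrite sepE.
have : 0 < sin (- ((x - a) / 2)) by apply: sin_gt0_pi; lra.
have : 0 < sin ((pi - x) / 2) by apply: sin_gt0_pi; lra.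
by rewrite sinN => s t; have := mulr_gt0 s t; lra.
Qed.

Variable w : R -> R.
Hypothesis iw : integ w.
Hypothesis w0 : aep (fun x => 0 <= w x).

(* With q = sep a, the functions (1 - q^n)^(2^n) tend to 1 where q < 1/2 and to
   0 where q > 1/2. *)
Lemma approx_halfline a : approx_rtrig w (\1_(`]a, +oo[%classic : set R)).
Proof.
have bi : bm (\1_(`]a, +oo[%classic : set R)).
  by apply: bm_indic; exact: measurable_itv.
(* For a outside [-pi, pi) the half-line contains the whole period or misses it, and a constant is
   enough. *)
have eqc c : (forall x, period x -> \1_(`]a, +oo[%classic : set R) x = c :> R) ->
    approx_rtrig w (\1_(`]a, +oo[%classic : set R)).
  move=> h e e0; exists (fun=> c); split; first exact: rtrig_cst.
  rewrite /d2 (@eq_rint _ _ (fun=> 0)) ?rint_cst ?mul0r// => x px.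
  by rewrite h// subrr expr0n mul0r.
have [ap|pa] := ltP a (- pi).
  apply: (eqc 1) => x; rewrite /period/= in_itv/= => /andP[px xp].
  by rewrite indicE mem_set//= in_itv/= (lt_le_trans ap px).
have [ap|{}ap] := leP pi a.
  apply: (eqc 0) => x; rewrite /period/= in_itv/= => /andP[px xp].
  by rewrite indicE memNset//= in_itv/= andbT ltNge (le_trans xp ap).
apply: (@approx_cvg _ _ iw w0 (fun n x => (1 - sep a x ^+ n) ^+ (2 ^ n)) _ 1) => //.
- move=> n; apply: (rtrig_bm _).1; apply: rtrigX; apply: rtrigBc.
  by apply: rtrigX; exact: rtrig_sep.
- apply: aepT => x _ n.
  by rewrite ler_norml; have := pow_step_ge0_le1 n (sep_ge0_le1 a x); lra.
- move=> n; apply: rtrig_approx; apply: rtrigX; apply: rtrigBc.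
  by apply: rtrigX; exact: rtrig_sep.
(* At a and at both endpoints [sep a] equals 1/2, where the powers need not tend to the indicator;
   these three points are null. *)
- have hpi : aep (fun x : R => x != - pi /\ x != pi).
    by apply: aepS2 (aep_neq (- pi)) (aep_neq pi).
  apply: aepS2 (aep_neq a) hpi => x.
  rewrite /period/= in_itv/= => /andP[px xp] xa [xp1 xp2].
  have px' : - pi < x by rewrite lt_neqAle eq_sym xp1.
  have xp' : x < pi by rewrite lt_neqAle xp2.
  have /andP[s0 s1] := sep_ge0_le1 a x.
  rewrite indicE; have [ax|ax|ax] := ltgtP a x.
  + rewrite mem_set/= ?in_itv/= ?ax//.
    by apply: pow_step_cvg1; rewrite s0 sep_lt// ax.
  + rewrite memNset/= ?in_itv/= ?andbT ?ltNge ?(ltW ax)//.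
    by apply: pow_step_cvg0; rewrite s1 sep_gt// ?px'// ltW.
  + by rewrite ax eqxx in xa.
Qed.

(** Half-lines are stable under intersection and generate the Borel sets. Approximability passes to
    complements by linearity and to countable disjoint unions by bounded convergence. *)
Lemma approx_indic (S : set R) : measurable S -> approx_rtrig w \1_S.
Proof.
move=> mS; apply: (@dynkin_induction _ _ (@RGenOInfty.G R)
  (fun S : set R => approx_rtrig w \1_S)).
- exact: RGenOInfty.measurableE.
- move=> _ _ [a ->] [b ->]; exists (Order.max a b).
  by apply/seteqP; split => x /=; rewrite !in_itv/= !andbT gt_max; [move=> [-> ->]|move=> /andP].
- have -> : \1_[set: R] = (fun=> 1) :> (R -> R).
    by apply/funext => x; rewrite indicE mem_set.
  by apply: rtrig_approx; exact: rtrig_cst.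
- by move=> _ [a ->]; exact: approx_halfline.
- move=> A mA aA.
  have -> : \1_(~` A) = (fun x => 1 + (-1) * \1_A x) :> (R -> R).
    apply/funext => x; rewrite !indicE in_setC.
    by case: (x \in A) => /=; ring.
  have bA := bm_indic mA.
  apply: approxD => //; first exact: bm_cst.
  + by apply: bmM => //; exact: bm_cst.
  + by apply: rtrig_approx; exact: rtrig_cst.
  + exact: approxZ.
- move=> F mF tF aF.
  have bU : bm (\1_(\bigcup_k F k) : R -> R).
    by apply: bm_indic; exact: bigcup_measurable.
  have bs n : bm (fun x => \sum_(k < n) \1_(F k) x).
    elim: n => [|n ih].
      by under eq_fun do rewrite big_ord0; exact: bm_cst.
    under eq_fun do rewrite big_ord_recr.
    by apply: bmD => //; exact: bm_indic.
  have as_ n : approx_rtrig w (fun x => \sum_(k < n) \1_(F k) x).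
    elim: n => [|n ih].
      by under eq_fun do rewrite big_ord0; apply: rtrig_approx; exact: rtrig_cst.
    under eq_fun do rewrite big_ord_recr.
    by apply: approxD => //; exact: bm_indic.
  (* Disjointness makes the partial sums indicators themselves, hence bounded by 1 uniformly in
     n. *)
  have sE x n : \sum_(k < n) \1_(F k) x = [exists k : 'I_n, x \in F k]%:R :> R.
    case: existsP => [[k xk]|nk].
      rewrite (bigD1 k)//= indicE xk big1 ?addr0// => j jk.
      rewrite indicE; case: (boolP (x \in F j)) => // xj.
      have /trivIsetP/(_ k j I I) := tF.
      move=> /(_ _)/seteqP[]; first by rewrite eq_sym; exact: jk.
      by move=> /(_ x) + _ => /(_ (conj (set_mem xk) (set_mem xj))).
    rewrite big1// => k _; rewrite indicE.
    by case: (boolP (x \in F k)) => // xk; exfalso; apply: nk; exists k.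
  apply: (@approx_cvg _ _ iw w0 (fun n x => \sum_(k < n) \1_(F k) x) _ 1) => //.
  + by move=> n; have [] := bs n.
  + apply: aepT => x _ n; rewrite sE.
    by case: [exists _, _]; rewrite ?normr1 ?normr0.
  + apply: aepT => x _; apply: cvg_near_cst; rewrite indicE.
    have [[k _ xk]|nk] := pselect ((\bigcup_k F k) x).
      exists k.+1 => // n /= kn; rewrite sE mem_set; last by exists k.
      case: existsP => // -[]; exists (Ordinal kn).
      by rewrite mem_set.
    apply: nearW => n; rewrite sE memNset//.
    case: existsP => // -[k /set_mem xk]; exfalso; apply: nk.
    by exists k.
- exact: (eq_ind _ (fun M : set_system R => M S) mS _ (RGenOInfty.measurableE R)).
Qed.

(** The sum counts the integers in [0, s), that is, it is the ceiling of s. *)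
Lemma count_lt (s : R) n : 0 <= s <= n%:R ->
  s <= \sum_(k < n) (k%:R < s)%R%:R <= s + 1.
Proof.
elim: n s => [|n ih] s /andP[s0 sn].
  by rewrite big_ord0; move: sn; lra.
rewrite big_ord_recr /=; have [sn'|ns] := leP s n%:R.
  by rewrite addr0; apply: ih; rewrite s0.
rewrite (eq_bigr (fun=> 1)); last first.
  move=> k _; rewrite (lt_trans _ ns)// ltr_nat; exact: ltn_ord.
rewrite sumr_const card_ord natr1 sn/= -natr1; lra.
Qed.

(** Layers: the average of the indicators of h > k/(n+1), k = 0, ..., n, is h rounded up to a
    multiple of 1/(n+1), so it converges to h uniformly. *)
Lemma approx_unit (h : R -> R) : mfun h -> aep (fun x => 0 <= h x <= 1) ->
  approx_rtrig w h.
Proof.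
move=> mh h01.
have bh : bm h.
  by split => //; exists 1; apply: aepS h01 => x _; rewrite ler_norml; lra.
pose A n k := period `&` h @^-1` `]k%:R / n.+1%:R, +oo[%classic.
have mA n k : measurable (A n k : set R) by apply: mh => //; exact: measurable_itv.
have bA n k : bm (\1_(A n k) : R -> R) by exact: bm_indic.
pose S m n x := \sum_(k < m) (\1_(A n k) : R -> R) x.
have bS m n : bm (S m n).
  rewrite /S; elim: m => [|m ih].
    by under eq_fun do rewrite big_ord0; exact: bm_cst.
  by under eq_fun do rewrite big_ord_recr; exact: bmD.
have aS m n : approx_rtrig w (S m n).
  rewrite /S; elim: m => [|m ih].
    by under eq_fun do rewrite big_ord0; apply: rtrig_approx; exact: rtrig_cst.
  under eq_fun do rewrite big_ord_recr.
  exact: approxD iw w0 _ _ (bS m n) (bA n m) ih (approx_indic (mA n m)).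
have SE x n : period x -> 0 <= h x <= 1 ->
    h x <= n.+1%:R^-1 * S n.+1 n x <= h x + n.+1%:R^-1.
  move=> px hx; have n0 : 0 < n.+1%:R :> R by [].
  have -> : S n.+1 n x = \sum_(k < n.+1) (k%:R < h x * n.+1%:R)%R%:R.
    apply: eq_bigr => k _; rewrite indicE -ltr_pdivrMr//; congr ((nat_of_bool _)%:R).
    apply/idP/idP => [/set_mem[_ /=]|kh].
      by rewrite in_itv/= andbT => ->.
    by rewrite mem_set//; split => //=; rewrite in_itv/= kh.
  have /count_lt : 0 <= h x * n.+1%:R <= n.+1%:R.
    have /andP[h0 h1] := hx.
    by rewrite mulr_ge0//= ler_piMl.
  move=> hc; rewrite [n.+1%:R^-1 * _]mulrC ler_pdivlMr// ler_pdivrMr//.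
  by rewrite mulrDl mulVf// gt_eqF.
apply: (@approx_cvg _ _ iw w0 (fun n x => n.+1%:R^-1 * S n.+1 n x) _ 2) => //.
- by move=> n; apply: mfunM; [exact: mfun_cst|exact: (bS _ _).1].
- apply: aepS h01 => x px hx n; have := SE x n px hx.
  have : n.+1%:R^-1 <= 1 :> R by rewrite invf_le1// ler1n.
  move: hx => /andP[h0 h1] z1 /andP[y0 y1].
  rewrite ler_norml; apply/andP; split.
    by rewrite (le_trans _ y0)// (le_trans _ h0)// oppr_le0.
  by apply: (le_trans y1); rewrite -[2]/(1 + 1) lerD.
- by move=> n; exact: approxZ.
- apply: aepS h01 => x px hx.
  have c : (fun n => h x + n.+1%:R^-1) @ \oo --> h x.
    rewrite -[X in _ --> X]addr0; apply: cvgD; first exact: cvg_cst.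
    exact: cvg_harmonic.
  apply: (squeeze_cvgr _ (@cvg_cst _ (h x) _ \oo _) c).
  by apply: nearW => n; exact: SE.
Qed.

Lemma bm_approx (h : R -> R) : bm h -> approx_rtrig w h.
Proof.
move=> bh; have [mh [M hM]] := bh.
(* The added 1 keeps L positive, so that h can be rescaled affinely into [0, 1] whatever M is. *)
pose L := `|M| + 1; have L0 : 0 < L by rewrite ltr_wpDl.
have bk : bm (fun x => (2 * L)^-1 * (h x + L)).
  by apply: bmM; [exact: bm_cst|apply: bmD => //; exact: bm_cst].
have ak : approx_rtrig w (fun x => (2 * L)^-1 * (h x + L)).
  apply: approx_unit; first exact: bk.1.
  apply: aepS hM => x _ hx.
  have : `|h x| <= L by rewrite (le_trans hx)// /L; have := ler_norm M; lra.
  rewrite ler_norml mulrC => /andP[h1 h2].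
  by rewrite ler_pdivlMr ?ler_pdivrMr; lra.
have -> : h = (fun x => - L + 2 * L * ((2 * L)^-1 * (h x + L))).
  by apply/funext => x; field; lra.
apply: approxD => //; first exact: bm_cst.
- by apply: bmM => //; exact: bm_cst.
- by apply: rtrig_approx; exact: rtrig_cst.
- exact: approxZ.
Qed.
End HalfLines.

(** * Complex-valued functions, their integrability and their means *)

Section ComplexLayer.
Context {R : realType}.
Local Notation mu := (@lebesgue_measure R).
Implicit Types (z : R[i]) (h p F G : R -> R[i]).
Local Notation Re := (@complex.Re R).
Local Notation Im := (@complex.Im R).

(** The squared modulus as a real polynomial in the two parts, within reach of [ring] and [field];
    it equals the square of [cabs]. *)
Definition sqn z : R := Re z ^+ 2 + Im z ^+ 2.

Lemma sqn_ge0 z : 0 <= sqn z.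
Proof. by rewrite addr_ge0// sqr_ge0. Qed.

Lemma cabs_sqr z : cabs z ^+ 2 = sqn z.
Proof. by rewrite /cabs sqr_sqrtr// sqn_ge0. Qed.

Lemma sqnM z z' : sqn (z * z') = sqn z * sqn z'.
Proof. by case: z => a b; case: z' => c d; rewrite /sqn /=; ring. Qed.

Lemma sqnN z : sqn (- z) = sqn z.
Proof. by case: z => a b; rewrite /sqn /=; ring. Qed.

Lemma sqnC (a : R) : sqn a%:C = a ^+ 2.
Proof. by rewrite /sqn /=; ring. Qed.

Lemma sqnD_le z z' : sqn (z + z') <= 2 * sqn z + 2 * sqn z'.
Proof.
case: z => a b; case: z' => c d; rewrite /sqn /=.
by have := sqr_ge0 (a - c); have := sqr_ge0 (b - d); nra.
Qed.

Lemma sqn_eq0 z : sqn z = 0 -> z = 0.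
Proof.
case: z => a b; rewrite /sqn /= => /eqP.
by rewrite paddr_eq0 ?sqr_ge0// !sqrf_eq0 => /andP[/eqP -> /eqP ->].
Qed.

(** Iterating [sqnD_le] gives a crude constant; only its independence of t matters. *)
Lemma sqn_sum_le n (z_ : 'I_n -> R[i]) (t : R) : 0 <= t ->
  (forall j, sqn (z_ j) <= t) -> sqn (\sum_(j < n) z_ j) <= (4 ^ n)%:R * t.
Proof.
move=> t0; elim: n z_ => [|n ih] z_ zt.
  by rewrite big_ord0 expn0 mul1r /sqn /= expr0n addr0.
rewrite big_ord_recr expnS natrM; apply: le_trans (sqnD_le _ _) _.
have := ih (fun j => z_ (widen_ord (leqnSn n) j)) (fun j => zt _).
have := zt ord_max; have : t <= (4 ^ n)%:R * t.
  by rewrite ler_peMl// ler1n expn_gt0.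
set T := (4 ^ n)%:R * t; rewrite -mulrA -/T; lra.
Qed.

Lemma ReM z z' : Re (z * z') = Re z * Re z' - Im z * Im z'.
Proof. by case: z => a b; case: z'. Qed.
Lemma ImM z z' : Im (z * z') = Re z * Im z' + Im z * Re z'.
Proof. by case: z => a b; case: z'. Qed.
Lemma ReD z z' : Re (z + z') = Re z + Re z'.
Proof. by case: z => a b; case: z'. Qed.
Lemma ImD z z' : Im (z + z') = Im z + Im z'.
Proof. by case: z => a b; case: z'. Qed.
Lemma ReB z z' : Re (z - z') = Re z - Re z'.
Proof. by case: z => a b; case: z'. Qed.
Lemma ImB z z' : Im (z - z') = Im z - Im z'.
Proof. by case: z => a b; case: z'. Qed.

Definition mfunC h : Prop := mfun (fun x => Re (h x)) /\ mfun (fun x => Im (h x)).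
Definition integC h : Prop := integ (fun x => Re (h x)) /\ integ (fun x => Im (h x)).
Definition bmC h : Prop := bm (fun x => Re (h x)) /\ bm (fun x => Im (h x)).

Lemma bmC_cst z : bmC (fun=> z).
Proof. by split; exact: bm_cst. Qed.

Lemma bmCM h p : bmC h -> bmC p -> bmC (fun x => h x * p x).
Proof.
move=> [h1 h2] [p1 p2]; split.
  by under eq_fun do rewrite ReM; apply: bmB; exact: bmM.
by under eq_fun do rewrite ImM; apply: bmD; exact: bmM.
Qed.

Lemma bmCD h p : bmC h -> bmC p -> bmC (fun x => h x + p x).
Proof.
move=> [h1 h2] [p1 p2]; split.
  by under eq_fun do rewrite ReD; exact: bmD.
by under eq_fun do rewrite ImD; exact: bmD.
Qed.

Lemma bmCB h p : bmC h -> bmC p -> bmC (fun x => h x - p x).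
Proof.
move=> bh bp; under eq_fun do rewrite -mulN1r.
by apply: bmCD => //; apply: bmCM => //; exact: bmC_cst.
Qed.

Lemma bmC_sum (I : Type) (s : seq I) (h : I -> R -> R[i]) :
  (forall i, bmC (h i)) -> bmC (fun x => \sum_(i <- s) h i x).
Proof.
move=> bh; elim: s => [|i s ih].
  by under eq_fun do rewrite big_nil; exact: bmC_cst.
by under eq_fun do rewrite big_cons; exact: bmCD.
Qed.

Lemma bmC_sqn h : bmC h -> bm (fun x => sqn (h x)).
Proof. by move=> [h1 h2]; apply: bmD; exact: bmX. Qed.

Lemma bmC_integC h : bmC h -> integC h.
Proof. by move=> [[m1 [M hM]] [m2 [L hL]]]; split; [exact: integ_bdd hM|exact: integ_bdd hL]. Qed.

Lemma integCM h F : bmC h -> integC F -> integC (fun x => h x * F x).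
Proof.
move=> [h1 h2] [p1 p2]; split.
  under eq_fun do rewrite ReM.
  by apply: (@integB _ (fun x => Re (h x) * Re (F x)) (fun x => Im (h x) * Im (F x)));
    exact: integ_bmM.
under eq_fun do rewrite ImM.
by apply: (@integD _ (fun x => Re (h x) * Im (F x)) (fun x => Im (h x) * Re (F x)));
  exact: integ_bmM.
Qed.

Lemma integCD F G : integC F -> integC G -> integC (fun x => F x + G x).
Proof.
move=> [F1 F2] [G1 G2]; split.
  by under eq_fun do rewrite ReD; exact: integD.
by under eq_fun do rewrite ImD; exact: integD.
Qed.

Lemma integCZ z F : integC F -> integC (fun x => z * F x).
Proof. by apply: integCM; exact: bmC_cst. Qed.

Lemma integCB F G : integC F -> integC G -> integC (fun x => F x - G x).
Proof.
move=> iF iG; under eq_fun do rewrite -mulN1r.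
by apply: integCD => //; exact: integCZ.
Qed.

Lemma integC_sum (I : Type) (s : seq I) (F : I -> R -> R[i]) :
  (forall i, integC (F i)) -> integC (fun x => \sum_(i <- s) F i x).
Proof.
move=> iF; elim: s => [|i s ih].
  by under eq_fun do rewrite big_nil; apply: bmC_integC; exact: bmC_cst.
by under eq_fun do rewrite big_cons; exact: integCD.
Qed.

Lemma cmeanE F : cmean F =
  ((2 * pi)^-1 * rint (fun x => Re (F x))) +i* ((2 * pi)^-1 * rint (fun x => Im (F x))).
Proof.
rewrite /cmean -/(rint (fun x => Re (F x))) -/(rint (fun x => Im (F x))).
by apply/eqP; rewrite eq_complex /= !mul0r subr0 addr0 !eqxx.
Qed.

Lemma cmeanD F G : integC F -> integC G ->
  cmean (fun x => F x + G x) = cmean F + cmean G.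
Proof.
move=> [F1 F2] [G1 G2]; rewrite !cmeanE.
under eq_fun do rewrite ReD.
under [X in _ +i* (_ * rint X)]eq_fun do rewrite ImD.
by rewrite !rintD// !mulrDr.
Qed.

Lemma cmeanZ z F : integC F -> cmean (fun x => z * F x) = z * cmean F.
Proof.
move=> [F1 F2]; rewrite !cmeanE.
under eq_fun do rewrite ReM.
under [X in _ +i* (_ * rint X)]eq_fun do rewrite ImM.
rewrite rintB ?rintD ?rintZ//; do ?exact: integZ.
by apply/eqP; rewrite eq_complex; case: z => a b /=; apply/andP; split; apply/eqP; ring.
Qed.

Lemma cmeanB F G : integC F -> integC G ->
  cmean (fun x => F x - G x) = cmean F - cmean G.
Proof.
move=> iF iG; under eq_fun do rewrite -mulN1r.
by rewrite cmeanD ?cmeanZ ?mulN1r//; exact: integCZ.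
Qed.

Lemma cmean_cst z : cmean (fun=> z) = z.
Proof.
have pi0 := pi_gt0 R.
rewrite cmeanE !rint_cst; case: z => a b /=.
by apply/eqP; rewrite eq_complex /=; apply/andP; split; apply/eqP; field; lra.
Qed.

Lemma cmean_sum (I : Type) (s : seq I) (F : I -> R -> R[i]) :
  (forall i, integC (F i)) ->
  cmean (fun x => \sum_(i <- s) F i x) = \sum_(i <- s) cmean (F i).
Proof.
move=> iF; elim: s => [|i s ih].
  by under eq_fun do rewrite big_nil; rewrite cmean_cst big_nil.
under eq_fun do rewrite big_cons.
by rewrite cmeanD// ?big_cons ?ih//; exact: integC_sum.
Qed.

Lemma eq_cmean F G : (forall x, period x -> F x = G x) -> cmean F = cmean G.
Proof.
by move=> h; rewrite !cmeanE; congr (_ * _ +i* (_ * _)); apply: eq_rint => x px; rewrite h.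
Qed.

End ComplexLayer.

(** * Exponentials, Fourier coefficients and the split into low and observed frequencies *)

Section Exponentials.
Context {R : realType}.
Local Notation mu := (@lebesgue_measure R).
Implicit Types (h p : R -> R[i]).
Local Notation Re := (@complex.Re R).
Local Notation Im := (@complex.Im R).

Lemma cexpD k l (x : R) : cexp (k + l) x = cexp k x * cexp l x.
Proof.
rewrite /cexp rmorphD/= mulrDl cosD sinD.
by apply/eqP; rewrite eq_complex /=; apply/andP; split; apply/eqP; ring.
Qed.

Lemma cexpN k (x : R) : cexp (- k) x = (cexp k x)^*.
Proof. by rewrite /cexp rmorphN/= mulNr cosN sinN. Qed.

Lemma cexp0 (x : R) : cexp 0 x = 1.
Proof. by rewrite /cexp mul0r cos0 sin0. Qed.

Lemma sqn_cexp k (x : R) : sqn (cexp k x) = 1.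
Proof. by rewrite /sqn /cexp /= cos2Dsin2. Qed.

Lemma bmC_cexp k : bmC (cexp k : R -> R[i]).
Proof.
have cm : continuous (fun x : R => k%:~R * x) by move=> x; exact: mulrl_continuous.
split; (split; [apply: continuous_mfun => x; apply: continuous_comp; first exact: cm
               |exists 1; apply: aepT => x _ /=]).
- exact: continuous_cos.
- by rewrite ler_norml cos_geN1 cos_le1.
- exact: continuous_sin.
- by rewrite ler_norml sin_geN1 sin_le1.
Qed.

Lemma bmC_trigpoly N (c : 'cV[R[i]]_N.+1) : bmC (trigpoly c).
Proof.
rewrite /trigpoly; apply: bmC_sum => j.
by apply: bmCM; [exact: bmC_cst|exact: bmC_cexp].
Qed.

Lemma sin_int_pi (k : int) : sin (k%:~R * pi) = 0 :> R.
Proof.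
have sn (n : nat) : sin (n%:R * pi) = 0 :> R.
  elim: n => [|n ih]; first by rewrite mul0r sin0.
  by rewrite -natr1 mulrDl mul1r sinDpi ih oppr0.
case: k => n; first exact: sn.
by rewrite NegzE rmorphN/= mulNr sinN -[_%:~R]/(n.+1%:R) sn oppr0.
Qed.

Lemma rint_derive (F f : R -> R) : continuous f ->
  (forall x : R, is_derive x 1 F (f x)) -> rint f = F pi - F (- pi).
Proof.
move=> cf dF; have pi0 := pi_gt0 R.
have pp : - pi < pi :> R by lra.
have cF x : {for x, continuous F}.
  by apply: differentiable_continuous; apply/derivable1_diffP; exact: ex_derive.
rewrite /rint /Rintegral (@continuous_FTC2 _ f F)//.
- exact: continuous_subspaceT.
- split.
  + by move=> x _; exact: ex_derive.
  + by apply: cvg_at_right_filter; exact: cF.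
  + by apply: cvg_at_left_filter; exact: cF.
- by move=> x _; rewrite derive1E; exact: derive_val.
Qed.

Lemma cmean_cexp (k : int) : cmean (cexp k : R -> R[i]) = (k == 0)%:R.
Proof.
have [->|k0] := eqVneq k 0.
  by rewrite (@eq_cmean _ _ (fun=> 1)) ?cmean_cst// => x _; rewrite cexp0.
have kR : k%:~R != 0 :> R by rewrite intr_eq0.
have cm : continuous (fun x : R => k%:~R * x) by move=> x; exact: mulrl_continuous.
rewrite cmeanE /cexp /=.
have ccos : continuous (fun x : R => cos (k%:~R * x)).
  by move=> x; apply: continuous_comp; [exact: cm|exact: continuous_cos].
have csin : continuous (fun x : R => sin (k%:~R * x)).
  by move=> x; apply: continuous_comp; [exact: cm|exact: continuous_sin].
have dsin (x : R) :
    is_derive x 1 (fun x : R => k%:~R^-1 * sin (k%:~R * x)) (cos (k%:~R * x)).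
  apply: is_derive_eq.
  by rewrite !scaler1 /GRing.scale/=; field.
have dcos (x : R) :
    is_derive x 1 (fun x : R => - k%:~R^-1 * cos (k%:~R * x)) (sin (k%:~R * x)).
  apply: is_derive_eq.
  by rewrite !scaler1 /GRing.scale/=; field.
rewrite (rint_derive ccos dsin) (rint_derive csin dcos).
by rewrite !mulrN sinN cosN sin_int_pi oppr0 !mulr0 !subrr !mulr0.
Qed.

Lemma cmean_trigpoly N (c : 'cV[R[i]]_N.+1) (j : 'I_N.+1) :
  cmean (fun x => trigpoly c x * cexp (- j%:Z) x) = c j 0.
Proof.
under eq_fun do rewrite /trigpoly big_distrl/=.
under eq_fun do under eq_bigr do rewrite -mulrA -cexpD.
rewrite cmean_sum => [|i]; last first.
  by apply: integCZ; apply: bmC_integC; exact: bmC_cexp.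
rewrite (bigD1 j)//= cmeanZ ?cmean_cexp; last exact/bmC_integC/bmC_cexp.
rewrite subrr eqxx mulr1 big1 ?addr0// => i ij.
rewrite cmeanZ ?cmean_cexp; last exact/bmC_integC/bmC_cexp.
by rewrite subr_eq0 eqz_nat (_ : (i == j :> nat) = false) ?mulr0//; apply: negbTE.
Qed.

Lemma bmC_observed N p : observed N p -> bmC p.
Proof.
move=> [s [c [_ ->]]]; apply: bmC_sum => k.
by apply: bmCM; [exact: bmC_cst|exact: bmC_cexp].
Qed.

Lemma cmean_observed N p (j : 'I_N.+1) : observed N p ->
  cmean (fun x => p x * cexp (- j%:Z) x) = 0.
Proof.
move=> [s [c [hs ->]]].
under eq_fun do rewrite big_distrl/=.
under eq_fun do under eq_bigr do rewrite -mulrA -cexpD.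
rewrite cmean_sum => [|i]; last first.
  by apply: integCZ; apply: bmC_integC; exact: bmC_cexp.
rewrite big_seq big1// => k /hs ks.
rewrite cmeanZ ?cmean_cexp; last exact/bmC_integC/bmC_cexp.
rewrite subr_eq0; case: eqP ks => [->|_ _]; last by rewrite mulr0.
by rewrite lez_nat -ltnS ltn_ord.
Qed.

(** The frequency list in [observed] may have repetitions. Counting multiplicities moves sums over
    different lists onto one duplicate-free list, where their coefficients can be added. *)
Lemma sum_count (V : nmodType) (F : int -> V) (s t : seq int) :
  uniq t -> {subset s <= t} ->
  \sum_(k <- s) F k = \sum_(k <- t) F k *+ count_mem k s.
Proof.
move=> ut; elim: s => [|k s ih] st; first by rewrite big_nil big1.
rewrite big_cons ih => [|l ls]; last by apply: st; rewrite in_cons ls orbT.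
under [RHS]eq_bigr do rewrite /= mulrnDr.
rewrite big_split/=; congr (_ + _).
rewrite (bigD1_seq k) ?st ?mem_head//= eqxx mulr1n big1 ?addr0// => l.
by rewrite eq_sym => /negbTE ->.
Qed.

Lemma observedD N p q : observed N p -> observed N q ->
  observed N (fun x => p x + q x).
Proof.
move=> [s [c [hs ->]]] [t [d [ht ->]]].
pose r := undup (s ++ t).
exists r, (fun k => c k *+ count_mem k s + d k *+ count_mem k t); split.
  by move=> k; rewrite mem_undup mem_cat => /orP[/hs|/ht].
apply/funext => x.
rewrite (@sum_count _ _ s r) ?undup_uniq// => [|k ks]; last first.
  by rewrite mem_undup mem_cat ks.
rewrite (@sum_count _ _ t r) ?undup_uniq// => [|k ks]; last first.
  by rewrite mem_undup mem_cat ks orbT.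
rewrite -big_split/=; apply: eq_bigr => k _.
by rewrite mulrDl !mulrnAl.
Qed.

(** Sums of exponentials of arbitrary frequency: the intermediate stage between [rtrig], which knows
    no frequencies, and [observed], which forbids those in 0..N. *)
Inductive ctrig : (R -> R[i]) -> Prop :=
| ctrig_exp c k : ctrig (fun x => c * cexp k x)
| ctrigD p q of ctrig p & ctrig q : ctrig (fun x => p x + q x).

Lemma ctrigM p q : ctrig p -> ctrig q -> ctrig (fun x => p x * q x).
Proof.
elim=> [c k|{}p1 p2 _ ih1 _ ih2] tq; last first.
  by under eq_fun do rewrite mulrDl; apply: ctrigD; [exact: ih1|exact: ih2].
elim: tq => [d l|{}q1 q2 _ ih1 _ ih2]; last first.
  by under eq_fun do rewrite mulrDr; exact: ctrigD.
under eq_fun do rewrite mulrACA -cexpD.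
exact: ctrig_exp.
Qed.

Lemma ctrig_cst c : ctrig (fun=> c).
Proof.
have := ctrig_exp c 0; congr ctrig; apply/funext => x.
by rewrite cexp0 mulr1.
Qed.

Lemma rtrig_ctrig (p : R -> R) : rtrig p -> ctrig (fun x => (p x)%:C).
Proof.
elim=> [c|||{}p q _ bp _ bq|{}p q _ bp _ bq].
- exact: ctrig_cst.
- have := ctrigD (ctrig_exp (2^-1)%:C 1) (ctrig_exp (2^-1)%:C (- 1)).
  congr ctrig; apply/funext => x; rewrite cexpN /cexp mul1r.
  by apply/eqP; rewrite eq_complex /=; apply/andP; split; apply/eqP; lra.
- have := ctrigD (ctrig_exp (0 -i* 2^-1) 1) (ctrig_exp (0 +i* 2^-1) (- 1)).
  congr ctrig; apply/funext => x; rewrite cexpN /cexp mul1r.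
  by apply/eqP; rewrite eq_complex /=; apply/andP; split; apply/eqP; lra.
- by under eq_fun do rewrite rmorphD; exact: ctrigD.
- by under eq_fun do rewrite rmorphM; exact: ctrigM.
Qed.

(** The vector d collects the terms with frequency in 0..N; what remains is observed. *)
Lemma ctrig_split N p : ctrig p ->
  exists d : 'cV[R[i]]_N.+1, observed N (fun x => p x - trigpoly d x).
Proof.
elim=> [c k|{}p q _ [d hd] _ [e he]]; last first.
  exists (d + e).
  have := observedD hd he; congr observed; apply/funext => x.
  rewrite /trigpoly; under [in RHS]eq_bigr do rewrite mxE mulrDl.
  by rewrite big_split/= opprD addrACA.
have [/andP[k0 kN]|kN] := boolP (0 <= k <= N%:Z).
  case: k k0 kN => // k _ kN; rewrite lez_nat -ltnS in kN.
  exists (c *: delta_mx (Ordinal kN) 0), [::], (fun=> 0); split => //.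
  apply/funext => x; rewrite big_nil /trigpoly (bigD1 (Ordinal kN))//=.
  rewrite !mxE !eqxx mulr1 big1 ?addr0 ?subrr// => i ik.
  by rewrite !mxE (negbTE ik) mulr0 mul0r.
exists 0, [:: k], (fun=> c); split.
  by move=> l; rewrite inE => /eqP ->.
apply/funext => x; rewrite big_seq1 /trigpoly big1 ?subr0// => i _.
by rewrite mxE mul0r.
Qed.

End Exponentials.

(** * Bounded functions with vanishing low coefficients belong to L_2^N(w) *)

Section BoundedInL2N.
Context {R : realType}.
Local Notation mu := (@lebesgue_measure R).
Implicit Types (h p : R -> R[i]) (w : R -> R).
Local Notation Re := (@complex.Re R).
Local Notation Im := (@complex.Im R).

(** Cauchy-Schwarz against the constant 1, read off from the nonnegative integral of (G - m)^2 with
    m the average of G. *)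
Lemma sqr_rint_le (G : R -> R) : integ G -> integ (fun x => G x ^+ 2) ->
  rint G ^+ 2 <= 2 * pi * rint (fun x => G x ^+ 2).
Proof.
move=> iG iG2; have pi0 := pi_gt0 R.
set m := rint G / (2 * pi).
have i1 : integ (fun x => m * G x) by exact: integZ.
have i2 : integ (fun x => 2 * (m * G x)) by exact: integZ.
have i3 : integ (fun=> m ^+ 2 : R) by exact: integ_cst.
have : 0 <= rint (fun x => G x ^+ 2 - 2 * (m * G x) + m ^+ 2).
  apply: rint_ge0.
    by apply: integ_mfun; apply: integD => //; exact: integB.
  by apply: aepT => x _; have := sqr_ge0 (G x - m); nra.
rewrite rintD ?rintB ?rint_cst ?(rintZ 2)//; last exact: integB.
rewrite rintZ//.
have mE : m * (2 * pi) = rint G by rewrite /m; field; lra.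
rewrite -mE => H; nra.
Qed.

Lemma sqn_cmean_le h : bmC h ->
  sqn (cmean h) <= (2 * pi)^-1 * rint (fun x => sqn (h x)).
Proof.
move=> bh; have [b1 b2] := bh; have [i1 i2] := bmC_integC bh.
have pi0 := pi_gt0 R.
have s1 : integ (fun x => Re (h x) ^+ 2).
  by have [m [M hM]] := bmX 2 b1; exact: integ_bdd hM.
have s2 : integ (fun x => Im (h x) ^+ 2).
  by have [m [M hM]] := bmX 2 b2; exact: integ_bdd hM.
rewrite cmeanE /sqn /= rintD// !exprMn -mulrDr.
have c0 : 0 < (2 * pi)^-1 :> R by rewrite invr_gt0 mulr_gt0.
have := sqr_rint_le i1 s1; have := sqr_rint_le i2 s2.
set A := rint (fun x => Re (h x)); set B := rint (fun x => Im (h x)).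
set C := rint _; set D := rint _ => h1 h2.
rewrite expr2 -mulrA ler_wpM2l ?(ltW c0)// mulrC ler_pdivrMr; last lra.
rewrite mulrDl; lra.
Qed.

Lemma wdist2E w h p : bmC h -> bmC p -> integ w ->
  wdist2 w h p =
  ((2 * pi)^-1 * rint (fun x => sqn (h x - p x) * w x))%:E.
Proof.
move=> bh bp iw; rewrite /wdist2 -mean_rint; last first.
  by apply: integ_bmM => //; apply: bmC_sqn; exact: bmCB.
by congr mean; apply/funext => x; rewrite cabs_sqr.
Qed.

(* Approximating in L_2(w + 1) rather than L_2(w) also makes the Fourier
   coefficients of the approximants converge, so that those of index 0..N,
   which tend to 0, may be removed. *)
Lemma bmC_L2N N h w : bmC h ->
  (forall j : 'I_N.+1, cmean (fun x => h x * cexp (- j%:Z) x) = 0) ->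
  integ w -> aep (fun x => 0 <= w x) -> L2N N w h.
Proof.
move=> bh h0 iw w0; have pi0 := pi_gt0 R; have [b1 b2] := bh.
split; [exact: b1.1|exact: b2.1| |].
  by rewrite wdist2E ?ltry//; exact: bmC_cst.
move=> e e0.
pose W x := w x + 1.
have iW : integ W by apply: integD => //; exact: integ_cst.
have W0 : aep (fun x => 0 <= W x) by apply: aepS w0 => x _; rewrite /W; lra.
have c0 : 0 < (2 * pi)^-1 :> R by rewrite invr_gt0 mulr_gt0.
set c : R := (2 * pi)^-1 in c0 *.
have rw0 : 0 <= rint w by apply: rint_ge0 => //; exact: integ_mfun.
pose Q : R := (4 ^ N.+1)%:R.
have Q0 : 0 <= Q by [].
(* Chosen so that the final estimate comes out as e: the error of p contributes 4 (e/K), and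
   removing the low frequencies, whose polynomial has squared modulus at most Q t with t = 2 c
   (e/K), contributes 2 Q t [rint w]; all is multiplied by c. *)
pose K := c * (4 + 4 * Q * c * rint w).
have K0 : 0 < K by rewrite mulr_gt0// ltr_wpDr// !mulr_ge0// ltW.
have dl0 : 0 < e / K by rewrite divr_gt0.
have [p1 [t1 a1]] := bm_approx iW W0 b1 dl0.
have [p2 [t2 a2]] := bm_approx iW W0 b2 dl0.
pose p x : R[i] := (p1 x)%:C + 'i * (p2 x)%:C.
have pE x : p x = p1 x +i* p2 x.
  by rewrite /p; apply/eqP; rewrite eq_complex /=; apply/andP; split; apply/eqP; ring.
have tp : ctrig p.
  apply: ctrigD; first exact: rtrig_ctrig.
  by apply: ctrigM; [exact: ctrig_cst|exact: rtrig_ctrig].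
have [d od] := ctrig_split N tp.
set q := (fun x => _) in od.
exists q; split => //.
have bp : bmC p.
  split; under eq_fun do rewrite pE.
    exact: rtrig_bm t1.
  exact: rtrig_bm t2.
have bq := bmC_observed od.
have bd : bmC (trigpoly d) by exact: bmC_trigpoly.
have bhp : bmC (fun x => h x - p x) by exact: bmCB.
have bs := bmC_sqn bhp.
have iW' : integ (fun x => sqn (h x - p x) * W x) by exact: integ_bmM.
have iw' : integ (fun x => sqn (h x - p x) * w x) by exact: integ_bmM.
have rW : rint (fun x => sqn (h x - p x) * W x) < 2 * (e / K).
  have -> : rint (fun x => sqn (h x - p x) * W x) =
      d2 W (fun x => Re (h x)) p1 + d2 W (fun x => Im (h x)) p2.
    rewrite /d2 -rintD; try by apply: integ_d2 => //; exact: rtrig_bm.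
    by congr rint; apply/funext => x; rewrite -mulrDl /sqn ReB ImB pE.
  lra.
have rs : rint (fun x => sqn (h x - p x)) <= rint (fun x => sqn (h x - p x) * W x).
  apply: le_rint => //.
    by have [m [M hM]] := bs; exact: integ_bdd hM.
  apply: aepS w0 => x _ wx; rewrite ler_peMr ?sqn_ge0//.
  by rewrite /W; lra.
have rw : rint (fun x => sqn (h x - p x) * w x) <= rint (fun x => sqn (h x - p x) * W x).
  apply: le_rint => //; apply: aepT => x _; rewrite ler_wpM2l ?sqn_ge0//.
  by rewrite /W; lra.
pose t := c * (2 * (e / K)).
have t0 : 0 <= t by rewrite !mulr_ge0// ?ltW// invr_gt0.
(* The j-th coefficient vanishes for h by assumption and for q because q is observed, so that of h -
   p is minus that of the removed polynomial, namely - d j. The mean square of h - p bounds it. *)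
have dj (j : 'I_N.+1) : sqn (d j 0) <= t.
  have bj : bmC (cexp (- j%:Z) : R -> R[i]) by exact: bmC_cexp.
  have -> : d j 0 = - cmean (fun x => (h x - p x) * cexp (- j%:Z) x).
    rewrite -(cmean_trigpoly d j) -[RHS]addr0 -(oppr0 (R[i])) -(cmean_observed j od).
    rewrite -opprD -cmeanD; try by apply: bmC_integC; exact: bmCM.
    rewrite -[LHS]opprK; congr (- _); rewrite -mulN1r -cmeanZ; last first.
      by apply: bmC_integC; exact: bmCM.
    rewrite -[LHS]add0r -[X in X + _](h0 j) -cmeanD; first last.
    - by apply: bmC_integC; apply: bmCM; [exact: bmC_cst|exact: bmCM].
    - by apply: bmC_integC; exact: bmCM.
    by congr cmean; apply/funext => x; rewrite /q; ring.
  rewrite sqnN; apply: le_trans (sqn_cmean_le _) _; first exact: bmCM.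
  rewrite ler_wpM2l ?(ltW c0)//.
  under eq_fun do rewrite sqnM sqn_cexp mulr1.
  by apply: le_trans rs _; exact: ltW.
have sd x : sqn (trigpoly d x) <= Q * t.
  by apply: sqn_sum_le => // j; rewrite sqnM sqn_cexp mulr1.
rewrite wdist2E// lte_fin -/c.
have : rint (fun x => sqn (h x - q x) * w x) <=
    2 * rint (fun x => sqn (h x - p x) * w x) + 2 * (Q * t) * rint w.
  rewrite -!rintZ// -rintD; try exact: integZ.
  apply: le_rint.
  - by apply: integ_bmM => //; apply: bmC_sqn; exact: bmCB.
  - by apply: integD; exact: integZ.
  apply: aepS w0 => x _ wx; rewrite mulrA -mulrDl ler_wpM2r//.
  have -> : h x - q x = (h x - p x) + trigpoly d x by rewrite /q; ring.
  by apply: le_trans (sqnD_le _ _) _; have := sd x; lra.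
move=> hq.
have : rint (fun x => sqn (h x - q x) * w x) < 4 * (e / K) + 2 * (Q * t) * rint w.
  by lra.
have -> : 4 * (e / K) + 2 * (Q * t) * rint w = c^-1 * e.
  by rewrite /t /K; field; rewrite ?gt_eqF//; move: K0; rewrite /K pmulr_rgt0.
by rewrite mulrC ltr_pdivlMr// mulrC.
Qed.

End BoundedInL2N.

(** * The optimal characteristic and its error at a fixed pair of densities *)

Section OptimalCharacteristic.
Context {R : realType}.
Local Notation mu := (@lebesgue_measure R).
Local Notation Re := (@complex.Re R).
Local Notation Im := (@complex.Im R).
Implicit Types (f g psi : R -> R) (h : R -> R[i]).

(** An integrable extended-real function is finite almost everywhere, which excludes f + g = 0 up to
    a null set. The real inverse, 0 at 0, is dominated by the extended one. *)
Lemma inv_integrable_pos f g : spectral_density f -> spectral_density g ->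
  inv_integrable f g ->
  aep (fun x => 0 < f x + g x) /\ integ (fun x => (f x + g x)^-1).
Proof.
move=> [if_ f0] [ig g0] hfg.
have mu_ : mfun (fun x => f x + g x).
  by apply: mfunD; exact: integ_mfun.
have u0 x : period x -> 0 <= f x + g x by move=> px; rewrite addr_ge0 ?f0 ?g0.
pose E x := (((f x + g x)%:E)^-1)%E.
have EE : E = fun x => if f x + g x == 0 then +oo%E else ((f x + g x)^-1)%:E.
  by apply/funext => x; rewrite /E inver.
have mE : measurable_fun period E.
  rewrite EE; apply: measurable_fun_if => //.
  - exact: measurable_period.
  - exact: (measurable_fun_eqr mu_ (mfun_cst 0)).
  - have mV : measurable_fun period (fun x => ((f x + g x)^-1)%:E).
      by have /measurable_EFinP := mfunV mu_.
    by apply: measurable_funS mV; [exact: measurable_period|move=> x []].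
have E0 x : period x -> (0 <= E x)%E.
  move=> px; rewrite EE; case: ifP => _; first exact: leey.
  by rewrite lee_fin invr_ge0 u0.
have iE : mu.-integrable period E.
  apply/integrableP; split => //.
  under eq_integral => x /set_mem px do rewrite gee0_abs ?E0//.
  exact: hfg.
split.
  have := @integrable_ae _ _ _ mu _ measurable_period _ iE.
  apply: aepS => x px; rewrite EE; case: eqP => // /eqP ux _.
  by rewrite lt_neqAle eq_sym ux u0.
apply: (@le_integrable _ _ _ mu _ measurable_period _ _ _ _ iE).
  by have /measurable_EFinP := mfunV mu_.
by move=> x px; rewrite EE /=; case: eqP => // _; exact: leey.
Qed.

Lemma aepI (P Q : R -> Prop) : aep P -> aep Q -> aep (fun x => P x /\ Q x).
Proof. by apply: aepS2. Qed.

Lemma sqn_conj (z : R[i]) : z * z^* = (sqn z)%:C.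
Proof.
by case: z => x y; apply/eqP; rewrite eq_complex /sqn /=; apply/andP; split; apply/eqP; ring.
Qed.

Lemma integC_real (F : R -> R) : integ F -> integC (fun x => (F x)%:C).
Proof. by move=> iF; split => //=; exact: integ_cst. Qed.

Lemma cmean_real (F : R -> R) :
  cmean (fun x => (F x)%:C) = ((2 * pi)^-1 * rint F)%:C.
Proof. by rewrite cmeanE /= rint_cst !mul0r mulr0. Qed.

Section FixedN.
Variable N : nat.
Implicit Types (a c : 'cV[R[i]]_N.+1).

Definition orthogonal_low h : Prop :=
  forall j : 'I_N.+1, cmean (fun x => h x * cexp (- j%:Z) x) = 0.

(** Translates matrix equations such as B c = R a into equalities of Fourier coefficients. *)
Lemma toeplitz_mulE psi c j : integ psi -> (toeplitz N psi *m c) j 0 =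
  cmean (fun x => trigpoly c x * (psi x)%:C * cexp (- j%:Z) x).
Proof.
move=> ip; rewrite mxE.
have ie k : integC (fun x => cexp (- (j%:Z - k%:Z)) x * (psi x)%:C).
  by apply: integCM; [exact: bmC_cexp|exact: integC_real].
under eq_bigr do rewrite mxE mulrC -cmeanZ//.
rewrite -cmean_sum => [|k]; last exact: integCZ.
congr cmean; apply/funext => x; rewrite /trigpoly !big_distrl/=.
apply: eq_bigr => k _; rewrite opprB cexpD; ring.
Qed.

Lemma cmean_mul_conj_trigpoly c h : integC h ->
  cmean (fun x => h x * (trigpoly c x)^*) =
  \sum_(j < N.+1) (c j 0)^* * cmean (fun x => h x * cexp (- j%:Z) x).
Proof.
move=> ih.
have ie (j : 'I_N.+1) : integC (fun x => h x * cexp (- j%:Z) x).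
  by under eq_fun do rewrite mulrC; apply: integCM => //; exact: bmC_cexp.
under [RHS]eq_bigr do rewrite -cmeanZ//.
rewrite -cmean_sum => [|k]; last exact: integCZ.
congr cmean; apply/funext => x; rewrite /trigpoly rmorph_sum big_distrr/=.
by apply: eq_bigr => j _; rewrite rmorphM/= cexpN; ring.
Qed.

Lemma dotc_toeplitz psi c a : integ psi -> dotc (toeplitz N psi *m c) a =
  cmean (fun x => trigpoly c x * (psi x)%:C * (trigpoly a x)^*).
Proof.
move=> ip; rewrite cmean_mul_conj_trigpoly; last first.
  by apply: integCM; [exact: bmC_trigpoly|exact: integC_real].
by apply: eq_bigr => j _; rewrite toeplitz_mulE// mulrC.
Qed.

Lemma dotc_toeplitz_self psi c : integ psi -> dotc (toeplitz N psi *m c) c =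
  ((2 * pi)^-1 * rint (fun x => sqn (trigpoly c x) * psi x))%:C.
Proof.
move=> ip; rewrite dotc_toeplitz// -cmean_real; congr cmean.
by apply/funext => x; rewrite mulrAC sqn_conj -rmorphM.
Qed.

Section Densities.
Variables (f g : R -> R).
Hypotheses (sf : spectral_density f) (sg : spectral_density g).
Hypothesis hinv : inv_integrable f g.
Let u x := f x + g x.

Let if_ : integ f. Proof. by case: sf. Qed.
Let ig : integ g. Proof. by case: sg. Qed.
Let f0 x : period x -> 0 <= f x. Proof. by case: sf => _; exact. Qed.
Let g0 x : period x -> 0 <= g x. Proof. by case: sg => _; exact. Qed.
Let iu : integ u. Proof. exact: integD. Qed.
Let u0 : aep (fun x => 0 < u x).
Proof. by have [] := inv_integrable_pos sf sg hinv. Qed.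
Let iV : integ (fun x => (u x)^-1).
Proof. by have [] := inv_integrable_pos sf sg hinv. Qed.

Lemma integ_ratio : integ (fun x => f x / (f x + g x)).
Proof.
apply: (@integ_bdd _ 1).
  by apply: mfunM; [exact: integ_mfun|exact: integ_mfun iV].
apply: aepS u0 => x px ux; rewrite ger0_norm; last first.
  by rewrite divr_ge0 ?f0// ltW.
by rewrite ler_pdivrMr// mul1r /u lerDl g0.
Qed.

Lemma integ_parallel : integ (fun x => f x * g x / (f x + g x)).
Proof.
apply: integ_dom if_.
  apply: mfunM; [|exact: integ_mfun iV].
  by apply: mfunM; exact: integ_mfun.
apply: aepS u0 => x px ux; rewrite ger0_norm; last first.
  by rewrite divr_ge0 ?mulr_ge0 ?f0 ?g0// ltW.
by rewrite ler_pdivrMr// ler_wpM2l ?f0// lerDr f0.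
Qed.

(** If B c = 0, the quadratic form of B at c, which is the mean of |trigpoly c|^2 / u, is zero. So
    the polynomial vanishes almost everywhere, and c, being its Fourier coefficients, is zero. The
    transposition adapts a criterion on row vectors to columns. *)
Lemma Bmx_unit : Bmx N f g \in unitmx.
Proof.
rewrite -unitmx_tr -row_free_unit; apply: inj_row_free => v.
move=> /(congr1 trmx); rewrite trmx_mul trmxK trmx0.
set c := v^T => Bc; rewrite -[v]trmxK -/c; suff -> : c = 0 by rewrite trmx0.
have pi0 := pi_gt0 R.
have := dotc_toeplitz_self c iV; rewrite -/(Bmx N f g) Bc /dotc big1; last first.
  by move=> k _; rewrite mxE mul0r.
move=> /(congr1 Re) /= /esym/eqP; rewrite mulf_eq0 invr_eq0 mulf_eq0.
rewrite (gt_eqF pi0) pnatr_eq0/= => /eqP r0.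
have z : aep (fun x => trigpoly c x = 0).
  have h0 : aep (fun x => sqn (trigpoly c x) * (u x)^-1 = 0).
    apply: rint_eq0_aep => //.
      by apply: integ_bmM iV; apply: bmC_sqn; exact: bmC_trigpoly.
    by apply: aepS u0 => x _ ux; rewrite mulr_ge0 ?sqn_ge0 ?invr_ge0 ?ltW.
  apply: aepS2 h0 u0 => x _ /eqP; rewrite mulf_eq0 invr_eq0 => /orP[/eqP/sqn_eq0//|].
  by move=> /eqP ->; rewrite ltxx.
apply/matrixP => j k; rewrite ord1 [RHS]mxE -(cmean_trigpoly c j).
have [[m1 _] [m2 _]] : bmC (fun x => trigpoly c x * cexp (- j%:Z) x).
  by apply: bmCM; [exact: bmC_trigpoly|exact: bmC_cexp].
rewrite cmeanE (@aep_eq_rint _ _ (fun=> 0))//; last 2 first.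
- exact: mfun_cst.
- by apply: aepS z => x _ ->; rewrite mul0r.
rewrite (@aep_eq_rint _ (fun x => Im _) (fun=> 0))//; last 2 first.
- exact: mfun_cst.
- by apply: aepS z => x _ ->; rewrite mul0r.
by rewrite rint_cst mul0r mulr0.
Qed.

Variable a : 'cV[R[i]]_N.+1.
Let C := trigpoly (Ccoef a f g).
Let A := trigpoly a.

Lemma Bmx_Ccoef : Bmx N f g *m Ccoef a f g = Rmx N f g *m a.
Proof. by rewrite /Ccoef mulmxA mulmxV ?mul1mx//; exact: Bmx_unit. Qed.

Definition char0 x : R[i] := numer a f g x / (f x + g x)%:C.

Lemma char0E x : char0 x =
  A x * (f x / (f x + g x))%:C - C x * ((f x + g x)^-1)%:C.
Proof. by rewrite /char0 /numer -/A -/C mulrBl rmorphM !fmorphV mulrA. Qed.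

Lemma integC_char0 : integC char0.
Proof.
have -> : char0 = fun x => A x * (f x / (f x + g x))%:C - C x * ((f x + g x)^-1)%:C.
  by apply/funext => x; rewrite char0E.
apply: integCB; apply: integCM; try exact: bmC_trigpoly; apply: integC_real => //.
exact: integ_ratio.
Qed.

Lemma char0_orthogonal : orthogonal_low char0.
Proof.
move=> j; have := Bmx_Ccoef => /matrixP/(_ j 0).
rewrite !toeplitz_mulE//; last exact: integ_ratio.
have be : bmC (cexp (- j%:Z) : R -> R[i]) by exact: bmC_cexp.
move=> E; under eq_fun do rewrite char0E mulrBl.
rewrite cmeanB ?E ?subrr//; under eq_fun do rewrite mulrC;
  apply: integCM => //; apply: integCM; try exact: bmC_trigpoly;
  apply: integC_real => //.
exact: integ_ratio.
Qed.

(** Replacing R a by B c turns the first term of the objective into the quadratic form of B at c, so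
    both terms become means of explicit integrands. *)
Lemma Re_objective : Re (objective a f g) = (2 * pi)^-1 *
  rint (fun x => sqn (C x) * (u x)^-1 + sqn (A x) * (f x * g x / u x)).
Proof.
rewrite /objective -/(Ccoef a f g) -Bmx_Ccoef.
rewrite dotc_toeplitz_self// dotc_toeplitz_self; last exact: integ_parallel.
rewrite /= -mulrDr -rintD//; apply: integ_bmM => //; try exact: integ_parallel;
  by apply: bmC_sqn; exact: bmC_trigpoly.
Qed.

(* The square-integrable functions that satisfy the linear conditions
   characterising L_2^N(f+g). *)
Definition adm h : Prop :=
  [/\ mfunC h, integ (fun x => sqn (h x) * u x) & orthogonal_low h].

Lemma mfun_sqn h : mfunC h -> mfun (fun x => sqn (h x)).
Proof. by move=> [m1 m2]; apply: mfunD; exact: mfunX. Qed.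

(** Arithmetic-geometric mean in place of Cauchy-Schwarz. With s = 1 it shows that F is integrable;
    with small s it turns an integral of |F|^2 u below s^2 into a bound of order s on the integral
    of F. *)
Lemma amgm_aep (F : R -> R[i]) s : 0 < s -> aep (fun x =>
  `|Re (F x)| <= s^-1 * (sqn (F x) * u x) + s * (u x)^-1 /\
  `|Im (F x)| <= s^-1 * (sqn (F x) * u x) + s * (u x)^-1).
Proof.
move=> s0; apply: aepS u0 => x _ ux.
have key (y z : R) : `|y| <= s^-1 * ((y ^+ 2 + z ^+ 2) * u x) + s * (u x)^-1.
  have si : 0 < s^-1 by rewrite invr_gt0.
  have ui : 0 < (u x)^-1 by rewrite invr_gt0.
  rewrite -(real_normK (num_real y)); set r := `|y|.
  apply: (@le_trans _ _ (s^-1 * (r ^+ 2 * u x) + s * (u x)^-1)); last first.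
    by rewrite lerD2r ler_wpM2l ?(ltW si)// ler_wpM2r ?(ltW ux)// lerDl sqr_ge0.
  have h1 : 0 <= (s * u x)^-1 * (r * u x - s) ^+ 2.
    by rewrite mulr_ge0 ?sqr_ge0// invr_ge0 mulr_ge0// ltW.
  have r0 : 0 <= r by exact: normr_ge0.
  have e : (s * u x)^-1 * (r * u x - s) ^+ 2 =
     s^-1 * (r ^+ 2 * u x) + s * (u x)^-1 - 2 * r.
    by field; rewrite !gt_eqF.
  by rewrite e in h1; lra.
by split; rewrite /sqn; [|rewrite [_ ^+ 2 + _]addrC]; exact: key.
Qed.

Lemma adm_integC h : mfunC h -> integ (fun x => sqn (h x) * u x) -> integC h.
Proof.
move=> [m1 m2] ih; have b := amgm_aep h ltr01.
have ib : integ (fun x => 1^-1 * (sqn (h x) * u x) + 1 * (u x)^-1).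
  by apply: integD; exact: integZ.
by split; apply: integ_dom ib => //; apply: aepS b => x _ [].
Qed.

Lemma integ_sqnB h p : mfunC h -> mfunC p ->
  integ (fun x => sqn (h x) * u x) -> integ (fun x => sqn (p x) * u x) ->
  integ (fun x => sqn (h x - p x) * u x).
Proof.
move=> mh mp ih ip.
have mhp : mfunC (fun x => h x - p x).
  have [m1 m2] := mh; have [n1 n2] := mp; split.
    by under eq_fun do rewrite ReB; exact: mfunB.
  by under eq_fun do rewrite ImB; exact: mfunB.
apply: (@integ_dom _ _ (fun x => 2 * (sqn (h x) * u x) + 2 * (sqn (p x) * u x))).
- by apply: mfunM; [exact: mfun_sqn|exact: integ_mfun].
- apply: aepS u0 => x _ ux; rewrite ger0_norm; last first.
    by rewrite mulr_ge0 ?sqn_ge0// ltW.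
  rewrite !mulrA -mulrDl ler_wpM2r ?(ltW ux)//.
  by have := sqnD_le (h x) (- p x); rewrite sqnN.
- by apply: integD; exact: integZ.
Qed.

(** Since 1/u is integrable, Fourier coefficients are continuous on L_2(u), so their vanishing
    passes from observed sums to the closure. *)
Lemma L2N_adm h : L2N N (f \+ g) h -> adm h.
Proof.
move=> [m1 m2 fin ap].
have pi0 := pi_gt0 R.
have mh : mfunC h by split.
have ih : integ (fun x => sqn (h x) * u x).
  apply: integ_mean_lty.
  - by apply: mfunM; [exact: mfun_sqn|exact: integ_mfun].
  - by move=> x px; rewrite mulr_ge0 ?sqn_ge0// addr_ge0 ?f0 ?g0.
  - move: fin; rewrite /wdist2; congr (_ < _)%E; congr mean.
    by apply/funext => x; rewrite subr0 cabs_sqr.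
split => // j.
have be : bmC (cexp (- j%:Z) : R -> R[i]) by exact: bmC_cexp.
have iCh := adm_integC mh ih.
pose r := rint (fun x => (u x)^-1).
have small s : 0 < s ->
    `|Re (cmean (fun x => h x * cexp (- j%:Z) x))| <= s * (1 + r) /\
    `|Im (cmean (fun x => h x * cexp (- j%:Z) x))| <= s * (1 + r).
  move=> s0.
  (* Cancels the normalisation in [wdist2]: the integral of |h - p|^2 u is below s^2, so the first
     term of [amgm_aep] integrates to at most s. *)
  pose e := (2 * pi)^-1 * s ^+ 2.
  have c0 : 0 < (2 * pi)^-1 :> R by rewrite invr_gt0 mulr_gt0.
  have [|p [op hp]] := ap e; first by rewrite mulr_gt0// exprn_gt0.
  have bp := bmC_observed op.
  have mp : mfunC p by have [[? _] [? _]] := bp.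
  have ip : integ (fun x => sqn (p x) * u x).
    by apply: integ_bmM => //; exact: bmC_sqn.
  have ihp := integ_sqnB mh mp ih ip.
  have hp' : rint (fun x => sqn (h x - p x) * u x) < s ^+ 2.
    move: hp; rewrite /wdist2 (_ : (fun x => _) =
      (fun x => (sqn (h x - p x) * u x)%:E)); last first.
      by apply/funext => x; rewrite cabs_sqr.
    by rewrite mean_rint// lte_fin ltr_pM2l.
  pose F x := (h x - p x) * cexp (- j%:Z) x.
  have iF : integC F.
    rewrite /F; under eq_fun do rewrite mulrC; apply: integCM => //.
    by apply: integCB => //; exact: bmC_integC.
  have sF x : sqn (F x) = sqn (h x - p x) by rewrite sqnM sqn_cexp mulr1.
  (* The observed sum p has zero j-th coefficient and may be subtracted freely. *)
  have -> : cmean (fun x => h x * cexp (- j%:Z) x) = cmean F.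
    rewrite -[LHS]subr0 -(cmean_observed j op) -cmeanB; last 2 first.
    - by under eq_fun do rewrite mulrC; exact: integCM.
    - by apply: bmC_integC; exact: bmCM.
    by congr cmean; apply/funext => x; rewrite /F mulrBl.
  have ib : integ (fun x => s^-1 * (sqn (F x) * u x) + s * (u x)^-1).
    under eq_fun do rewrite sF.
    by apply: integD; exact: integZ.
  have rb : rint (fun x => s^-1 * (sqn (F x) * u x) + s * (u x)^-1) <= s * (1 + r).
    under eq_fun do rewrite sF.
    rewrite rintD ?rintZ//; try exact: integZ.
    rewrite mulrDr mulr1 lerD2r ler_pdivrMl// -expr2; exact: ltW.
  have c1 : (2 * pi)^-1 <= 1 :> R.
    by rewrite invf_le1; have := pi_ge2 R; lra.
  have bnd (G : R -> R) : integ G ->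
      aep (fun x => `|G x| <= s^-1 * (sqn (F x) * u x) + s * (u x)^-1) ->
      `|(2 * pi)^-1 * rint G| <= s * (1 + r).
    move=> iG hG; rewrite normrM (gtr0_norm c0).
    apply: le_trans (_ : `|rint G| <= _); first by rewrite ler_piMl.
    apply: le_trans (rint_norm iG) _; apply: le_trans rb.
    by apply: le_rint => //; exact: integ_norm.
  have [iF1 iF2] := iF.
  by rewrite cmeanE /=; split; apply: bnd => //; apply: aepS (amgm_aep F s0) => x _ [].
have r0 : 0 <= r.
  apply: rint_ge0; first exact: integ_mfun.
  by apply: aepS u0 => x _ ux; rewrite invr_ge0 ltW.
have zero (y : R) : (forall s, 0 < s -> `|y| <= s * (1 + r)) -> y = 0.
  move=> hy; apply/eqP; rewrite -normr_le0; apply/ler_addgt0Pl => e e0.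
  rewrite addr0; have r1 : 0 < 1 + r by rewrite ltr_wpDr.
  apply: le_trans (hy (e / (1 + r)) _) _; first by rewrite divr_gt0.
  by rewrite divfK// gt_eqF.
apply/eqP; rewrite eq_complex; apply/andP; split; apply/eqP; apply: zero => s s0.
  exact: (small s s0).1.
exact: (small s s0).2.
Qed.

(** Square integrability follows from |h0|^2 u <= 2 |A|^2 f^2/u + 2 |C|^2/u together with f^2/u <=
    f. *)
Lemma char0_adm : adm char0.
Proof.
have iC := integC_char0; have [i1 i2] := iC.
have mC : mfunC char0 by split; exact: integ_mfun.
split => //; last exact: char0_orthogonal.
apply: (@integ_dom _ _ (fun x => 2 * (sqn (A x) * f x) + 2 * (sqn (C x) * (u x)^-1))).
- by apply: mfunM; [exact: mfun_sqn|exact: integ_mfun].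
- apply: aepS u0 => x px ux; rewrite ger0_norm; last first.
    by rewrite mulr_ge0 ?sqn_ge0// ltW.
  rewrite char0E -/(u x).
  have ui : 0 < (u x)^-1 by rewrite invr_gt0.
  have uu : u x * (u x)^-1 = 1 by rewrite mulfV// gt_eqF.
  apply: (@le_trans _ _ ((2 * sqn (A x * (f x / u x)%:C) + 2 * sqn (C x * ((u x)^-1)%:C)) * u x)).
    rewrite ler_wpM2r ?(ltW ux)//.
    by have := sqnD_le (A x * (f x / u x)%:C) (- (C x * ((u x)^-1)%:C)); rewrite sqnN.
  rewrite !sqnM !sqnC.
  have -> : (2 * (sqn (A x) * (f x / u x) ^+ 2) + 2 * (sqn (C x) * (u x)^-1 ^+ 2)) * u x =
     2 * (sqn (A x) * (f x * (f x / u x))) + 2 * (sqn (C x) * (u x)^-1).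
    by field; rewrite gt_eqF.
  rewrite lerD2r ler_pM2l// ler_wpM2l ?sqn_ge0// ler_piMr ?f0//.
  by rewrite ler_pdivrMr// mul1r /u lerDl g0.
- by apply: integD; apply: integZ; apply: integ_bmM => //; apply: bmC_sqn; exact: bmC_trigpoly.
Qed.

Definition err h x : R := sqn (A x - h x) * f x + sqn (h x) * g x.

Lemma integ_errs h : mfunC h -> integ (fun x => sqn (h x) * u x) ->
  integ (fun x => sqn (A x - h x) * f x) /\ integ (fun x => sqn (h x) * g x).
Proof.
move=> mh ih; have ms := mfun_sqn mh.
have mf : mfun f by exact: integ_mfun.
have mg : mfun g by exact: integ_mfun.
have mAh : mfunC (fun x => A x - h x).
  have [[n1 _] [n2 _]] := bmC_trigpoly a; have [m1 m2] := mh; split.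
    by under eq_fun do rewrite ReB; exact: mfunB.
  by under eq_fun do rewrite ImB; exact: mfunB.
split.
  apply: (@integ_dom _ _ (fun x => 2 * (sqn (A x) * f x) + 2 * (sqn (h x) * u x))).
  - by apply: mfunM => //; exact: mfun_sqn.
  - apply: aepT => x px; rewrite ger0_norm ?mulr_ge0 ?sqn_ge0 ?f0//.
    apply: (@le_trans _ _ ((2 * sqn (A x) + 2 * sqn (h x)) * f x)).
      rewrite ler_wpM2r ?f0//.
      by have := sqnD_le (A x) (- h x); rewrite sqnN.
    rewrite mulrDl -!mulrA lerD2l ler_pM2l// ler_wpM2l ?sqn_ge0//.
    by rewrite /u lerDl g0.
  - apply: integD; apply: integZ => //.
    by apply: integ_bmM => //; apply: bmC_sqn; exact: bmC_trigpoly.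
apply: integ_dom ih; first exact: mfunM.
apply: aepT => x px; rewrite ger0_norm ?mulr_ge0 ?sqn_ge0 ?g0//.
by rewrite ler_wpM2l ?sqn_ge0// lerDr f0.
Qed.

Lemma DeltaE h : mfunC h -> integ (fun x => sqn (h x) * u x) ->
  Delta a h f g = ((2 * pi)^-1 * rint (err h))%:E.
Proof.
move=> mh ih; have [i1 i2] := integ_errs mh ih.
rewrite /Delta /err rintD// mulrDr EFinD -!mean_rint//.
by congr (mean _ + mean _)%E; apply/funext => x; rewrite cabs_sqr.
Qed.

(** Here A - h0 = (A g + C)/u and h0 = (A f - C)/u, and the cross terms in A and C cancel after
    weighting by f and g. *)
Lemma err_char0 x : 0 < u x -> err char0 x =
  sqn (C x) * (u x)^-1 + sqn (A x) * (f x * g x / u x).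
Proof.
move=> ux; rewrite /err char0E -/(u x).
(* Eliminating g makes u an atom, the only denominator for [field]. *)
have E : g x = u x - f x by rewrite /u; ring.
move: ux; rewrite E; move: (u x) (f x) (A x) (C x) => U F [p q] [r s] U0.
rewrite /sqn /=; field; exact: lt0r_neq0.
Qed.

Lemma err_pythagoras h : adm h ->
  rint (err h) = rint (err char0) + rint (fun x => sqn (h x - char0 x) * u x).
Proof.
move=> [mh ih oh]; have [m0 i0 o0] := char0_adm.
have [e1 e2] := integ_errs mh ih; have [e3 e4] := integ_errs m0 i0.
have ie : integ (err h) by exact: integD.
have ie0 : integ (err char0) by exact: integD.
have id := integ_sqnB mh m0 ih i0.
have iCh := adm_integC mh ih; have iC0 := adm_integC m0 i0.
pose G x := (h x - char0 x) * (C x)^*.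
have iB : integC (fun x => h x - char0 x) by exact: integCB.
have bC : bmC (fun x => (C x)^*).
  by have [b1 b2] := bmC_trigpoly (Ccoef a f g); split;
    [have -> : (fun x => Re (C x)^*) = (fun x => Re (C x))
    |have -> : (fun x => Im (C x)^*) = (fun x => 0 - Im (C x))] => //;
    try (by apply/funext => x; rewrite ?sub0r; case: (C x));
    apply: bmB => //; exact: bm_cst.
have iG : integC G.
  by rewrite /G; under eq_fun do rewrite mulrC; exact: integCM.
have G0 : rint (fun x => Re (G x)) = 0.
  have : cmean G = 0.
    rewrite /G cmean_mul_conj_trigpoly// big1// => j _.
    under eq_fun do rewrite mulrBl.
    rewrite cmeanB ?oh ?o0 ?subrr ?mulr0//; under eq_fun do rewrite mulrC;
      by apply: integCM => //; exact: bmC_cexp.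
  rewrite cmeanE => /(congr1 Re)/= /eqP; rewrite mulf_eq0 invr_eq0 mulf_eq0.
  by rewrite pnatr_eq0 (gt_eqF (pi_gt0 R))/= => /eqP.
(* The zero integral of the cross term is inserted on the right, so that both sides agree pointwise
   almost everywhere. *)
rewrite -rintD// -[RHS]subr0 -[X in _ - X](mulr0 2) -G0 -rintZ; last by case: iG.
have i2G : integ (fun x => 2 * Re (G x)) by apply: integZ; case: iG.
rewrite -rintB//; last exact: integD.
apply: aep_eq_rint; [exact: integ_mfun| |].
  by apply: integ_mfun; apply: integB => //; exact: integD.
apply: aepS u0 => x _ ux; rewrite /G /err char0E -/(u x).
have E : g x = u x - f x by rewrite /u; ring.
move: ux; rewrite E; move: (u x) (f x) (A x) (C x) (h x) => U F [p q] [r s] [k l] U0.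
rewrite /sqn /=; field; exact: lt0r_neq0.
Qed.

Lemma Delta_char0_le h : adm h -> (Delta a char0 f g <= Delta a h f g)%E.
Proof.
move=> ah; have [mh ih _] := ah; have [m0 i0 _] := char0_adm.
rewrite !DeltaE// lee_fin; apply: ler_wpM2l.
  by rewrite invr_ge0 mulr_ge0// pi_ge0.
rewrite (err_pythagoras ah) lerDl; apply: rint_ge0.
  exact: integ_mfun (integ_sqnB mh m0 ih i0).
by apply: aepS u0 => x _ ux; rewrite mulr_ge0 ?sqn_ge0 ?ltW.
Qed.

(** Identifies the objective with the error at [char0], which makes an assumption on the objective
    usable as one on minimal errors. *)
Lemma rint_err_char0 :
  rint (err char0) = 2 * pi * Re (objective a f g).
Proof.
have pi0 := pi_gt0 R; have [m0 i0 _] := char0_adm.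
have [e3 e4] := integ_errs m0 i0.
rewrite Re_objective mulrA mulfV ?mul1r; last lra.
apply: aep_eq_rint.
- by apply: integ_mfun; exact: integD.
- by apply: integ_mfun; apply: integD; apply: integ_bmM => //;
    try exact: integ_parallel; apply: bmC_sqn; exact: bmC_trigpoly.
- by apply: aepS u0 => x _; exact: err_char0.
Qed.

End Densities.
End FixedN.
End OptimalCharacteristic.

(** * The contamination class: boundedness of h0, the saddle point and the conclusions *)

Section LeastFavourable.
Context {R : realType}.
Local Notation mu := (@lebesgue_measure R).
Local Notation Re := (@complex.Re R).
Local Notation Im := (@complex.Im R).
Variables (N : nat) (a : 'cV[R[i]]_N.+1) (P2 eps alpha2 : R) (f g0 g1 : R -> R).
Hypotheses (eps01 : 0 < eps < 1) (sf : spectral_density f).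
Hypothesis (Dg0 : contamination eps P2 g1 g0).
Hypothesis (hinv : inv_integrable f g0).
Hypothesis alpha2_gt0 : 0 < alpha2.
Hypothesis g0E : aep (fun x =>
  g0 x = Num.max ((1 - eps) * g1 x) (alpha2 * cabs (numer a f g0 x) - f x)).
Hypothesis g0_max : forall g : R -> R, contamination eps P2 g1 g ->
  inv_integrable f g -> objective a f g <= objective a f g0.

Let h0 := char0 f g0 a.
Let u0 x := f x + g0 x.

Lemma contamination_density g : contamination eps P2 g1 g -> spectral_density g.
Proof. by case. Qed.

Lemma contamination_ge g : contamination eps P2 g1 g ->
  aep (fun x => (1 - eps) * g1 x <= g x).
Proof.
move=> [sg [w [[_ w0] gE]] _]; apply: (aepS _ gE) => x px ->.
by rewrite lerDl mulr_ge0 ?w0// ltW//; case/andP: eps01.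
Qed.

Lemma contamination_rint g : contamination eps P2 g1 g ->
  (2 * pi)^-1 * rint g <= P2.
Proof. by move=> [[ig _] _]; rewrite mean_rint// lee_fin. Qed.

Let sg0 := contamination_density Dg0.

Let u0_gt0 : aep (fun x => 0 < u0 x).
Proof. by have [] := inv_integrable_pos sf sg0 hinv. Qed.

Lemma sqn_char0 x : sqn (h0 x) = cabs (numer a f g0 x) ^+ 2 / u0 x ^+ 2.
Proof. by rewrite /h0 /char0 sqnM -fmorphV sqnC exprVn cabs_sqr. Qed.

Lemma char0_le : aep (fun x => sqn (h0 x) <= alpha2^-1 ^+ 2).
Proof.
apply: aepS2 g0E u0_gt0 => x _ gE ux; rewrite sqn_char0.
rewrite ler_pdivrMr ?exprn_gt0// -exprMn; apply: lerXn2r; rewrite ?nnegrE.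
- exact: sqrtr_ge0.
- by rewrite mulr_ge0 ?invr_ge0// ltW.
- have : alpha2 * cabs (numer a f g0 x) - f x <= g0 x.
    by rewrite gE le_max lexx orbT.
  by rewrite ler_pdivlMl// /u0; lra.
Qed.

Lemma bmC_char0 : bmC h0.
Proof.
have [i1 i2] := integC_char0 sf sg0 hinv a.
have a0 : 0 <= alpha2^-1 by rewrite invr_ge0 ltW.
split; (split; [exact: integ_mfun|exists alpha2^-1; apply: aepS char0_le => x _ hx]);
  rewrite -(@ler_pXn2r _ 2)// ?nnegrE// real_normK ?num_real//; apply: le_trans hx;
  by rewrite /sqn ?lerDl ?lerDr sqr_ge0.
Qed.

(** Covers every density g, whether or not 1/(f+g) is integrable, as the intersection [HD] demands;
    this is where the boundedness of h0 is spent. *)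
Lemma char0_L2N g : spectral_density g -> L2N N (f \+ g) h0.
Proof.
move=> [ig gp]; have [if_ fp] := sf; apply: bmC_L2N.
- exact: bmC_char0.
- exact: char0_orthogonal.
- exact: integD.
- by apply: aepT => x px; rewrite addr_ge0 ?fp ?gp.
Qed.

Lemma char0_optimal : optimal a f g0 h0.
Proof.
split; first exact: char0_L2N.
by move=> h' Lh; apply: Delta_char0_le => //; exact: L2N_adm.
Qed.

(* g0 + t is in the class, and the error of its optimal characteristic h,
   measured at g0, is smaller by the mean of t |h|^2. *)
Lemma slack_char0_eq0 : (2 * pi)^-1 * rint g0 < P2 ->
  aep (fun x => sqn (h0 x) = 0).
Proof.
move=> slack; have pi0 := pi_gt0 R; have [if_ fp] := sf; have [ig gp] := sg0.
have /andP[e0 e1] := eps01.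
pose t := P2 - (2 * pi)^-1 * rint g0.
have t0 : 0 < t by rewrite subr_gt0.
pose gt x := g0 x + t.
have igt : integ gt by apply: integD => //; exact: integ_cst.
have sgt : spectral_density gt.
  by split => // x px; rewrite addr_ge0 ?gp// ltW.
have Dgt : contamination eps P2 g1 gt.
  split => //.
    have [_ [w [[iw w0] gE]] _] := Dg0.
    exists (fun x => w x + t / eps); split.
      split; first by apply: integD => //; exact: integ_cst.
      by move=> x px; rewrite addr_ge0 ?w0// ltW// divr_gt0.
    apply: (aepS _ gE) => x px gx; rewrite /gt gx.
    by field; rewrite gt_eqF.
  rewrite mean_rint// lee_fin rintD ?rint_cst//; last exact: integ_cst.
  rewrite mulrDr /t le_eqVlt; apply/orP; left; apply/eqP; field; lra.
have ut x : period x -> 0 < f x + gt x.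
  by move=> px; have := fp x px; have := gp x px; rewrite /gt; lra.
have hinvt : inv_integrable f gt.
  have iV : integ (fun x => (f x + gt x)^-1).
    apply: (@integ_bdd _ t^-1).
      by apply: mfunV; apply: integ_mfun; exact: integD.
    apply: aepT => x px; rewrite ger0_norm ?invr_ge0 ?(ltW (ut x px))//.
    rewrite lef_pV2 ?posrE ?ut//.
    by have := fp x px; have := gp x px; rewrite /gt; lra.
  rewrite /inv_integrable; under eq_integral => x /set_mem px.
    rewrite inver (gt_eqF (ut x px)).
    over.
  by rewrite integralE// ltry.
set ht := char0 f gt a.
have [mt it ot] := char0_adm sf sgt hinvt a.
have [m0 i0 o0] := char0_adm sf sg0 hinv a.
have it0 : integ (fun x => sqn (ht x) * u0 x).
  apply: integ_dom it.
    by apply: mfunM; [exact: mfun_sqn|apply: integ_mfun; exact: integD].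
  apply: aepT => x px; rewrite ger0_norm ?mulr_ge0 ?sqn_ge0 ?addr_ge0 ?fp ?gp//.
  by rewrite ler_wpM2l ?sqn_ge0// /u0 /gt; lra.
have itt : integ (fun x => t * sqn (ht x)).
  apply: integ_dom it.
    by apply: mfunM; [exact: mfun_cst|exact: mfun_sqn].
  apply: aepT => x px; rewrite ger0_norm ?mulr_ge0 ?sqn_ge0 ?(ltW t0)//.
  rewrite mulrC ler_wpM2l ?sqn_ge0// /gt.
  by have := fp x px; have := gp x px; lra.
have At : adm N f g0 ht by split.
have [e1t e2t] := integ_errs sf sg0 a mt it0.
have ie : integ (err f g0 a ht) by exact: integD.
have errt : rint (err f gt a ht) = rint (err f g0 a ht) + rint (fun x => t * sqn (ht x)).
  by rewrite -rintD//; congr rint; apply/funext => x; rewrite /err /gt; ring.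
(* Both sides are errors of optimal characteristics, hence objectives up to the factor 2 pi; the
   order on R[i] yields the inequality of real parts. *)
have le_obj : rint (err f gt a ht) <= rint (err f g0 a h0).
  rewrite /ht /h0 !rint_err_char0// ler_pM2l; last lra.
  by have := g0_max Dgt hinvt; rewrite lecE => /andP[].
have pyth := err_pythagoras sf sg0 hinv a At; rewrite -/h0 in pyth.
have id := integ_sqnB sf sg0 hinv mt m0 it0 i0; rewrite -/h0 in id.
have r1 : 0 <= rint (fun x => t * sqn (ht x)).
  apply: rint_ge0; first exact: integ_mfun.
  by apply: aepT => x _; rewrite mulr_ge0 ?sqn_ge0 ?(ltW t0).
have r2 : 0 <= rint (fun x => sqn (ht x - h0 x) * u0 x).
  apply: rint_ge0; first exact: integ_mfun.
  by apply: aepS u0_gt0 => x _ ux; rewrite mulr_ge0 ?sqn_ge0 ?(ltW ux).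
rewrite -/u0 in pyth.
(* By [errt], [pyth] and [le_obj] two nonnegative integrals have sum at most 0. The first forces ht
   = 0, the second ht = h0, almost everywhere. *)
have z1 : aep (fun x => t * sqn (ht x) = 0).
  apply: rint_eq0_aep => //; last by lra.
  by apply: aepT => x _; rewrite mulr_ge0 ?sqn_ge0 ?(ltW t0).
have z2 : aep (fun x => sqn (ht x - h0 x) * u0 x = 0).
  apply: rint_eq0_aep => //; last by lra.
  by apply: aepS u0_gt0 => x _ ux; rewrite mulr_ge0 ?sqn_ge0 ?(ltW ux).
apply: aepS2 (aepI z1 z2) u0_gt0 => x _ [+ +] ux.
move=> /eqP; rewrite mulf_eq0 (gt_eqF t0)/= => /eqP/sqn_eq0 ->.
by move=> /eqP; rewrite mulf_eq0 (gt_eqF ux) orbF sub0r sqnN => /eqP.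
Qed.

Lemma saddle g : contamination eps P2 g1 g ->
  (Delta a h0 f g <= Delta a h0 f g0)%E.
Proof.
move=> Dg; have sg := contamination_density Dg.
have pi0 := pi_gt0 R.
have [if_ fp] := sf; have [ig gp] := sg; have [ig0 g0p] := sg0.
have bs : bm (fun x => sqn (h0 x)) by apply: bmC_sqn; exact: bmC_char0.
have m0 : mfunC h0 by have [[? _] [? _]] := bmC_char0.
have iug : integ (fun x => sqn (h0 x) * (f x + g x)).
  by apply: integ_bmM => //; exact: integD.
have iug0 : integ (fun x => sqn (h0 x) * (f x + g0 x)).
  by apply: integ_bmM => //; exact: integD.
have [e1 e2] := integ_errs sf sg a m0 iug.
have [e3 e4] := integ_errs sf sg0 a m0 iug0.
rewrite (DeltaE sf sg a m0 iug) (DeltaE sf sg0 a m0 iug0) lee_fin.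
apply: ler_wpM2l; first by rewrite invr_ge0; lra.
rewrite /err !rintD// lerD2l.
have [full|slack] := leP P2 ((2 * pi)^-1 * rint g0); last first.
  have z := slack_char0_eq0 slack.
  by apply: le_rint => //; apply: aepS z => x _ ->; rewrite !mul0r.
have gg0 : rint g <= rint g0.
  have := le_trans (contamination_rint Dg) full.
  by rewrite ler_pM2l// invr_gt0; lra.
pose k := alpha2^-1 ^+ 2.
have k0 : 0 <= k by exact: sqr_ge0.
have ik : integ (fun x => k * (g x - g0 x)) by apply: integZ; exact: integB.
(* The integral of k (g - g0), nonpositive at full power, is interposed between the two sides. *)
rewrite -subr_ge0; apply: le_trans (_ : - rint (fun x => k * (g x - g0 x)) <= _).
  rewrite rintZ ?rintB//; last exact: integB.
  by rewrite -mulrN mulr_ge0//; lra.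
rewrite lerNl opprB -rintB//; apply: le_rint => //; first exact: integB.
apply: aepS2 (aepI g0E u0_gt0) (aepI char0_le (contamination_ge Dg)).
move=> x px [gE ux] [hx gx]; rewrite -mulrBr.
have [lt|ge] := leP (alpha2 * cabs (numer a f g0 x) - f x) ((1 - eps) * g1 x).
  rewrite ler_wpM2r// subr_ge0 gE (max_idPl lt)//.
rewrite (max_idPr (ltW ge)) in gE.
have -> : sqn (h0 x) = k; last by [].
have uE : u0 x = alpha2 * cabs (numer a f g0 x) by rewrite /u0 gE; ring.
rewrite sqn_char0 /k; rewrite uE in ux *.
(* Positivity of u0 excludes a zero numerator, so the quotient is exactly k. *)
have c0 : cabs (numer a f g0 x) != 0.
  by apply: contraTneq ux => ->; rewrite mulr0 ltxx.
by field; rewrite c0 gt_eqF.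
Qed.

(** Since h0 is itself a candidate in L_2^N(f+g), the optimal error at g is at most that of h0 at g,
    which the saddle inequality bounds by the error at g0. *)
Lemma char0_least_favourable : least_favourable a f (contamination eps P2 g1) g0.
Proof.
split => //; exists h0; split; first exact: char0_optimal.
move=> g h Dg [_ /(_ h0) hopt]; apply: le_trans (saddle Dg).
by apply: hopt; apply: char0_L2N; exact: contamination_density Dg.
Qed.

(** For h in [HD] the largest error is at least the error at g0, hence at least that of the optimal
    h0 at g0, which by the saddle inequality dominates the error of h0 at every g. *)
Lemma char0_minimax_robust : minimax_robust a f (contamination eps P2 g1) h0.
Proof.
have H0 : HD N f (contamination eps P2 g1) h0.
  by move=> g Dg; apply: char0_L2N; exact: contamination_density Dg.
split => //; apply/eqP; rewrite eq_le; apply/andP; split.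
  by apply: ereal_inf_lbound; exists h0.
apply: le_ereal_inf_tmp => _ [h Hh <-]; apply: ge_ereal_sup => _ [g Dg <-].
apply: le_trans (saddle Dg) _; apply: le_trans (_ : Delta a h f g0 <= _)%E.
  by apply: char0_optimal.2; exact: Hh.
by apply: ereal_sup_ubound; exists g0.
Qed.

End LeastFavourable.

Theorem theorem7p6 (R : realType) (N : nat) (a : 'cV[R[i]]_N.+1)
    (P2 eps alpha2 : R) (f g0 g1 : R -> R)
    (hP2 : 0 < P2) (heps : 0 < eps < 1)
    (hg1 : spectral_density g1) (hf : spectral_density f)
    (hg0 : contamination eps P2 g1 g0)
    (hinv : inv_integrable f g0)
    (hbdd : exists M : R, \forall x \ae @lebesgue_measure R, period x ->
       cabs (numer a f g0 x) ^+ 2 / (f x + g0 x) ^+ 2 <= M)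
    (halpha2 : 0 < alpha2)
    (hg0eq : \forall x \ae @lebesgue_measure R, period x ->
       g0 x = Num.max ((1 - eps) * g1 x)
                      (alpha2 * cabs (numer a f g0 x) - f x))
    (hopt : forall g : R -> R, contamination eps P2 g1 g -> inv_integrable f g ->
       objective a f g <= objective a f g0) :
  least_favourable a f (contamination eps P2 g1) g0 /\
  minimax_robust a f (contamination eps P2 g1)
    (fun x : R => numer a f g0 x / (f x + g0 x)%:C).
Proof.
split.
  exact: (char0_least_favourable heps hf hg0 hinv halpha2 hg0eq hopt).
exact: (char0_minimax_robust heps hf hg0 hinv halpha2 hg0eq hopt).
Qed.
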